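(* Let $\xi\in\Gamma(\mathcal{S})$ be a unit spinor on a $7$-manifold $M$ and let $\varphi_\xi$ be the $G_2$-structure defined by $\varphi_\xi(\alpha,\beta,\gamma)=-\langle\xi,\alpha\cdot(\beta\cdot(\gamma\cdot\xi))\rangle_S$ for vector fields $\alpha,\beta,\gamma$. Then, for any $\eta\in\Gamma(\mathcal{S})$ and any vector field $X$, $$j_\xi\left(\nabla^S_X\eta\right)=D_X^{(\xi)}\left(j_\xi(\eta)\right),$$ where $D^{(\xi)}$ is the octonion covariant derivative with respect to the $G_2$-structure $\varphi_\xi$.
   Context: Spinors. $(M,g)$ is a Riemannian spin $7$-manifold, $\mathcal{S}$ is its real spinor bundle (rank $8$), $\cdot$ denotes Clifford multiplication (with $v\cdot v\cdot\eta=-|v|^2\eta$), $\langle\cdot,\cdot\rangle_S$ is the inner product on $\mathcal{S}$, for which Clifford multiplication by vectors is skew-adjoint, and $\nabla^S$ is the spinorial covariant derivative obtained by lifting the Levi-Civita connection $\nabla$ of $g$. It is known that $\varphi_\xi$ is a positive $3$-form whose associated metric is $g$, and that every spinor field can be written uniquely as $\eta=A\cdot\xi$ with $A=(a,\alpha)$ an octonion section, where $A\cdot\xi=a\xi+\alpha\cdot\xi$. $G_2$-structures and octonion bundle. A $G_2$-structure is identified with a positive $3$-form $\varphi$ (pointwise $GL(7,\mathbb{R})$-equivalent to $e^{123}+e^{145}+e^{167}+e^{246}-e^{257}-e^{347}-e^{356}$), which determines a metric $g$ and volume form by $g(u,v)\,\mathrm{vol}=\frac16(u\lrcorner\varphi)\wedge(v\lrcorner\varphi)\wedge\varphi$;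 $\psi=*\varphi$, with $*$ defined by this metric and volume form. $\mathbb{O}M=\Lambda^0\oplus TM$ ($\Lambda^0$ the trivial real line bundle), with sections $A=(a,\alpha)$; $\langle\alpha\times_\varphi\beta,\gamma\rangle=\varphi(\alpha,\beta,\gamma)$; octonion product $A\circ_\varphi B=(ab-\langle\alpha,\beta\rangle,\ a\beta+b\alpha+\alpha\times_\varphi\beta)$. The torsion $T$ of $\varphi$ is the $2$-tensor with $\nabla_a\varphi_{bcd}=2T_a{}^{e}\psi_{ebcd}$, and $T_X=(0,X\lrcorner T)$ is the imaginary octonion section with vector part $X^aT_a{}^b$. With $\nabla_X(a,\alpha)=(\nabla_Xa,\nabla_X\alpha)$, the octonion covariant derivative with respect to $\varphi$ is $D_XA=\nabla_XA-A\circ_\varphi T_X$. The map $j_\xi:\Gamma(\mathcal{S})\to\Gamma(\mathbb{O}M)$ is the linear map with $j_\xi(\xi)=1$ and $j_\xi(V\cdot\eta)=V\circ_{\varphi_\xi}j_\xi(\eta)$ for every octonion section $V$ and spinor $\eta$; in particular $j_\xi(A\cdot\xi)=A$. *)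

(* Defs.v *)
From HB Require Import structures.
From mathcomp Require Import all_boot all_order all_algebra all_fingroup.
From mathcomp Require Import all_classical all_reals all_analysis.

Set Implicit Arguments.
Unset Strict Implicit.
Unset Printing Implicit Defensive.

Import Order.TTheory GRing.Theory Num.Theory.
Import numFieldNormedType.Exports.

Local Open Scope classical_set_scope.
Local Open Scope ring_scope.

(** * Smooth 7-manifolds *)

(* [Ck_on k U f] is meant for open [U]. *)
Fixpoint Ck_on (R : realType) (V W : normedModType R) (k : nat) (U : set V)
    (f : V -> W) : Prop :=
  match k with
  | 0%N => forall x, U x -> {for x, continuous f}
  | k'.+1 => (forall x, U x -> differentiable f x) /\
             (forall v, Ck_on k' U (fun x => 'D_v f x))
  end.

Definition smooth_on (R : realType) (V W : normedModType R) (U : set V)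
    (f : V -> W) : Prop :=
  forall k, Ck_on k U f.

(* The atlas need not be maximal.  [chart_at] selects one chart around each
   point; it is only used to fix a model of the tangent spaces. *)
Record manifold7 (R : realType) := Manifold7 {
  mpoint :> topologicalType;
  mhausdorff : hausdorff_space mpoint;
  msecond_countable : @second_countable mpoint;
  chart : Type;
  dom : chart -> set mpoint;
  coord : chart -> mpoint -> 'rV[R]_7;
  param : chart -> 'rV[R]_7 -> mpoint;
  dom_open : forall c, open (dom c);
  codom_open : forall c, open (coord c @` dom c);
  coordK : forall c x, dom c x -> param c (coord c x) = x;
  coord_continuous : forall c x, dom c x -> {for x, continuous (coord c)};
  param_continuous : forall c y, (coord c @` dom c) y ->
    {for y, continuous (param c)};
  chart_at : mpoint -> chart;
  dom_chart_at : forall x, dom (chart_at x) x;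
  compatible : forall c d,
    smooth_on (coord c @` (dom c `&` dom d)) (coord d \o param c)
}.

(** The tangent space [T_x M] is modelled by ['rV[R]_7]: a vector is represented
    by its components in the chart [chart_at x] (its components in any other
    chart are given by [tcoord]).  Accordingly a vector field is a map
    [M -> 'rV[R]_7], but its smoothness is [smooth_vfield], not smoothness of
    that map. *)
Local Notation vfield M R := (mpoint M -> 'rV[R]_7).

Section Manifold.
Context {R : realType} {M : manifold7 R}.
Local Notation E := 'rV[R]_7.

Definition smooth_fun (W : normedModType R) (U : set M) (F : M -> W) : Prop :=
  forall c : chart M, smooth_on (coord c @` (U `&` dom c)) (F \o param c).

Definition tderiv (W : normedModType R) (x : M) (v : E) (F : M -> W) : W :=
  'D_v (F \o param (chart_at x)) (coord (chart_at x) x).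

Definition tcoord (c : chart M) (x : M) (v : E) : E := tderiv x v (coord c).

Definition smooth_vfield (U : set M) (X : vfield M R) : Prop :=
  forall c, smooth_fun (U `&` dom c) (fun x => tcoord c x (X x)).

Definition smooth_fun_near (x : M) (f : M -> R) : Prop :=
  exists U : set M, [/\ open U, U x & smooth_fun U f].

Definition smooth_vfield_near (x : M) (X : vfield M R) : Prop :=
  exists U : set M, [/\ open U, U x & smooth_vfield U X].

(** * Tensors, metrics and the Levi-Civita connection *)

Definition tensor2 (t : M -> E -> E -> R) : Prop :=
  [/\ forall x a u v w, t x (a *: u + v) w = a * t x u w + t x v w,
      forall x a u v w, t x w (a *: u + v) = a * t x w u + t x w v
    & forall (U : set M) X Y, open U -> smooth_vfield U X ->
        smooth_vfield U Y -> smooth_fun U (fun x => t x (X x) (Y x) : R)].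

Definition riemannian_metric (g : M -> E -> E -> R) : Prop :=
  [/\ tensor2 g,
      forall x u v, g x u v = g x v u
    & forall x u, u != 0 -> 0 < g x u u].

(* [nabla x v Y] is the covariant derivative of [Y] along [v] in [T_x M].
   Connections act on vector fields that are smooth near the point considered. *)
Record levi_civita (g : M -> E -> E -> R)
    (nabla : M -> E -> vfield M R -> E) : Prop := {
  nabla_linear : forall x a u v Y, smooth_vfield_near x Y ->
    nabla x (a *: u + v) Y = a *: nabla x u Y + nabla x v Y;
  nabla_add : forall x v Y Z, smooth_vfield_near x Y -> smooth_vfield_near x Z ->
    nabla x v (fun y => Y y + Z y) = nabla x v Y + nabla x v Z;
  nabla_leibniz : forall x v (f : M -> R) Y, smooth_fun_near x f ->
    smooth_vfield_near x Y ->
    nabla x v (fun y => f y *: Y y)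
      = tderiv x v (f : M -> R^o) *: Y x + f x *: nabla x v Y;
  nabla_smooth : forall (U : set M) X Y, open U -> smooth_vfield U X ->
    smooth_vfield U Y -> smooth_vfield U (fun y => nabla y (X y) Y);
  nabla_metric : forall x v Y Z, smooth_vfield_near x Y ->
    smooth_vfield_near x Z ->
    tderiv x v (fun y => g y (Y y) (Z y) : R^o)
      = g x (nabla x v Y) (Z x) + g x (Y x) (nabla x v Z);
  nabla_torsion_free : forall x X Y (f : M -> R), smooth_vfield_near x X ->
    smooth_vfield_near x Y -> smooth_fun_near x f ->
    tderiv x (nabla x (X x) Y - nabla x (Y x) X) (f : M -> R^o)
      = tderiv x (X x) (fun y => tderiv y (Y y) (f : M -> R^o))
        - tderiv x (Y x) (fun y => tderiv y (X y) (f : M -> R^o))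
}.

End Manifold.

(** * Exterior algebra of a 7-dimensional vector space *)

Section Exterior.
Context {R : realType}.
Local Notation E := 'rV[R]_7.

Definition kform (k : nat) := ('I_k -> E) -> R.

Definition is_kform k (w : kform k) : Prop :=
  (forall (i : 'I_k) (v : 'I_k -> E) (a : R) (u u' : E),
     w (fun j => if j == i then a *: u + u' else v j)
     = a * w (fun j => if j == i then u else v j)
       + w (fun j => if j == i then u' else v j)) /\
  (forall (i j : 'I_k) (v : 'I_k -> E), i != j -> v i = v j -> w v = 0).

Definition args (s : seq E) k : 'I_k -> E := fun i => nth 0 s i.

Definition contract k (u : E) (w : kform k.+1) : kform k :=
  fun v => w (fun i => if unlift ord0 i is Some j then v j else u).

Definition wedge p q (a : kform p) (b : kform q) : kform (p + q) := fun v =>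
  (p`! * q`!)%:R^-1 *
  \sum_(s : 'S_(p + q)) (-1) ^+ (s : bool)
     * a (fun i => v (s (lshift q i))) * b (fun j => v (s (rshift p j))).

Definition ebase (i : 'I_7) : E := delta_mx 0 i.

(* [edual h i] is [\sum_j h^{ij} e_j], with [h^{ij}] the inverse Gram matrix:
   the basis satisfying [h (edual h i) (ebase j) = (i == j)%:R]. *)
Definition edual (h : E -> E -> R) (i : 'I_7) : E :=
  \row_j invmx (\matrix_(k < 7, l < 7) h (ebase k) (ebase l)) i j.

Definition sharp (h : E -> E -> R) (l : E -> R) : E :=
  \sum_i l (ebase i) *: edual h i.

Lemma sharpP (h : E -> E -> R) (l : E -> R) (w : E) :
  (forall a u v z, h (a *: u + v) z = a * h u z + h v z) ->
  (forall u v, h u v = h v u) ->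
  (forall u, u != 0 -> 0 < h u u) ->
  (forall a u v, l (a *: u + v) = a * l u + l v) ->
  h (sharp h l) w = l w.
Proof.
move=> hlin hsym hpos llin.
have hlinr a u v z : h z (a *: u + v) = a * h z u + h z v.
  by rewrite hsym hlin !(hsym z).
have lsum (f : E -> R) : (forall a u v, f (a *: u + v) = a * f u + f v) ->
    forall (c : 'I_7 -> R) (b : 'I_7 -> E),
    f (\sum_i c i *: b i) = \sum_i c i * f (b i).
  move=> flin c b; have f0 : f 0 = 0.
    have := flin 1 0 0; rewrite scaler0 addr0 mul1r => /eqP.
    by rewrite -subr_eq subrr => /eqP.
  by apply: (big_ind2 (fun u a => f u = a)) => // [u a v b' <- <-|i _];
    [have := flin 1 u v; rewrite scale1r mul1r
    |have := flin (c i) (b i) 0; rewrite addr0 f0 addr0].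
have rowE (u : E) : u = \sum_i u 0 i *: ebase i by rewrite {1}[u]row_sum_delta.
set G := \matrix_(k < 7, m < 7) h (ebase k) (ebase m).
have Gunit : G \in unitmx.
  rewrite -row_free_unit; apply/inj_row_free => u uG.
  apply/eqP; apply: contraT => /hpos; rewrite {2}(rowE u).
  rewrite (lsum (h u)) //.
  suff hk k : h u (ebase k) = 0.
    by rewrite big1 ?ltxx // => k _; rewrite hk mulr0.
  have /rowP/(_ k) := uG; rewrite !mxE => <-.
  rewrite {1}(rowE u) (lsum (h^~ (ebase k))); last by move=> *; exact: hlin.
  by apply: eq_bigr => i _; rewrite mxE.
have hdual i k : h (edual h i) (ebase k) = (i == k)%:R.
  have /matrixP/(_ i k) := mulVmx Gunit; rewrite !mxE => <-.
  rewrite (rowE (edual h i)) (lsum (h^~ (ebase k))); last by move=> *; exact: hlin.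
  by apply: eq_bigr => j _; rewrite !mxE.
rewrite {1}(rowE w) {2}(rowE w) (lsum (h _)) // (lsum l) //.
apply: eq_bigr => k _; congr (_ * _).
rewrite /sharp (lsum (h^~ (ebase k))); last by move=> *; exact: hlin.
rewrite (bigD1 k) //= hdual eqxx mulr1 big1 ?addr0 // => i /negbTE ik.
by rewrite hdual ik mulr0.
Qed.

(* In index notation, [(1/k!) a^{i_1 .. i_k} vol_{i_1 .. i_k j_1 .. j_m}]. *)
Definition hodge k m (h : E -> E -> R) (vol : kform (k + m)) (a : kform k)
    : kform m := fun v =>
  k`!%:R^-1 * \sum_(f : {ffun 'I_k -> 'I_7})
    a (fun i => ebase (f i))
    * vol (fun i => match fintype.split i with
                    | inl i' => edual h (f i')
                    | inr j => v j
                    end).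

End Exterior.

(** * G2-structures, torsion and the octonion bundle *)

Section G2.
Context {R : realType} {M : manifold7 R}.
Local Notation E := 'rV[R]_7.

Definition is_volume_of (h : E -> E -> R) (vol : @kform R 7) : Prop :=
  is_kform vol /\
  forall e : 'I_7 -> E, (forall i j, h (e i) (e j) = (i == j)%:R) ->
    `|vol e| = 1.

(* [g] and [vol] are the metric and volume form determined by [phi]:
   g(u,v) vol = 1/6 (u _| phi) /\ (v _| phi) /\ phi.
   Such a pair is unique when it exists, and it exists when [phi] is positive;
   positivity itself is not part of the predicate. *)
Definition associated_metric_volume (phi : M -> @kform R 3)
    (g : M -> E -> E -> R) (vol : M -> @kform R 7) : Prop :=
  [/\ riemannian_metric g,
      forall x, is_volume_of (g x) (vol x)
    & forall x u v w,
        g x u v * vol x w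
        = 6^-1 * wedge (wedge (contract u (phi x)) (contract v (phi x)))
                       (phi x) w].

Definition nabla_form3 (nabla : M -> E -> vfield M R -> E)
    (phi : M -> @kform R 3) (x : M) (v : E) (Y Z W : vfield M R) : R :=
  tderiv x v (fun y => phi y (@args R [:: Y y; Z y; W y] 3) : R^o)
  - phi x (@args R [:: nabla x v Y; Z x; W x] 3)
  - phi x (@args R [:: Y x; nabla x v Z; W x] 3)
  - phi x (@args R [:: Y x; Z x; nabla x v W] 3).

(* nabla_a phi_bcd = 2 T_a^e psi_ebcd, with psi = * phi. *)
Definition is_torsion (g : M -> E -> E -> R) (vol : M -> @kform R 7)
    (nabla : M -> E -> vfield M R -> E) (phi : M -> @kform R 3)
    (T : M -> E -> E -> R) : Prop :=
  tensor2 T /\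
  forall x v Y Z W, smooth_vfield_near x Y -> smooth_vfield_near x Z ->
    smooth_vfield_near x W ->
    nabla_form3 nabla phi x v Y Z W
    = 2 * @hodge R 3 4 (g x) (vol x) (phi x)
            (@args R [:: sharp (g x) (T x v); Y x; Z x; W x] 4).

(** Octonions at a point: [R^o * 'rV[R]_7], i.e. pairs (a, alpha). *)
Definition smooth_octonion (A : M -> R^o * E) : Prop :=
  smooth_fun setT (fun x => (A x).1) /\ smooth_vfield setT (fun x => (A x).2).

Definition cross (h : E -> E -> R) (phi : @kform R 3) (u v : E) : E :=
  sharp h (fun w => phi (@args R [:: u; v; w] 3)).

Definition octmul (h : E -> E -> R) (phi : @kform R 3) (A B : R^o * E)
    : R^o * E :=
  (A.1 * B.1 - h A.2 B.2, A.1 *: B.2 + B.1 *: A.2 + cross h phi A.2 B.2).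

Definition nabla_oct (nabla : M -> E -> vfield M R -> E) (x : M) (v : E)
    (A : M -> R^o * E) : R^o * E :=
  (tderiv x v (fun y => (A y).1), nabla x v (fun y => (A y).2)).

Definition octonion_D (g : M -> E -> E -> R)
    (nabla : M -> E -> vfield M R -> E) (phi : M -> @kform R 3)
    (T : M -> E -> E -> R) (X : vfield M R) (A : M -> R^o * E) (x : M)
    : R^o * E :=
  nabla_oct nabla x (X x) A
  - octmul (g x) (phi x) (A x) (0, sharp (g x) (T x (X x))).

End G2.

(** * Spin structures and real spinors *)

Section Spin.
Context {R : realType}.
Local Notation E := 'rV[R]_7.

(* A real 8-dimensional orthogonal representation of the Clifford algebra of
   R^7 (with v.v = -|v|^2); both inequivalent representations are allowed. *)
Definition clifford_rep (gam : 'I_7 -> 'M[R]_8) : Prop :=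
  (forall a, (gam a)^T = - gam a) /\
  (forall a b, gam a *m gam b + gam b *m gam a = (- 2 * (a == b)%:R)%:M).

Definition cliff (gam : 'I_7 -> 'M[R]_8) (u : 'I_7 -> R) : 'M[R]_8 :=
  \sum_a u a *: gam a.

(* Spin(7), as the group of products of an even number of unit vectors; it is
   faithfully represented on R^8 by [gam]. *)
Inductive spin7 (gam : 'I_7 -> 'M[R]_8) : 'M[R]_8 -> Prop :=
| spin7_one : spin7 gam 1%:M
| spin7_mul (u v : 'I_7 -> R) (h : 'M[R]_8) :
    \sum_a u a ^+ 2 = 1 -> \sum_a v a ^+ 2 = 1 -> spin7 gam h ->
    spin7 gam (cliff gam u *m cliff gam v *m h).

(* A spin structure on (M, g), given by local sections of the principal bundle:
   local orthonormal frames [frame i] over an open cover, and a lift [trans] to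
   Spin(7), satisfying the cocycle condition, of the transition functions of
   these frames.  [frame_trans] says that [trans i j x] covers the change of
   frame, i.e. that h gam_a h^-1 is Clifford multiplication by [frame j a],
   expressed in the frame [frame i].  In particular M is oriented. *)
Record spin_structure (M : manifold7 R) (g : M -> E -> E -> R)
    (gam : 'I_7 -> 'M[R]_8) := SpinStructure {
  spin_index : Type;
  spin_dom : spin_index -> set M;
  frame : spin_index -> 'I_7 -> vfield M R;
  trans : spin_index -> spin_index -> M -> 'M[R]_8;
  spin_dom_open : forall i, open (spin_dom i);
  frame_smooth : forall i a, smooth_vfield (spin_dom i) (frame i a);
  frame_orthonormal : forall i x, spin_dom i x -> forall a b,
    g x (frame i a x) (frame i b x) = (a == b)%:R;
  trans_smooth : forall i j,
    smooth_fun (spin_dom i `&` spin_dom j) (trans i j);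
  trans_spin : forall i j x, spin_dom i x -> spin_dom j x ->
    spin7 gam (trans i j x);
  trans_cocycle : forall i j k x, spin_dom i x -> spin_dom j x ->
    spin_dom k x -> trans i j x *m trans j k x = trans i k x;
  frame_trans : forall i j x, spin_dom i x -> spin_dom j x -> forall a,
    trans i j x *m gam a *m invmx (trans i j x)
    = cliff gam (fun b => g x (frame j a x) (frame i b x));
  spin_at : M -> spin_index;
  spin_dom_at : forall x, spin_dom (spin_at x) x
}.

(** The spinor bundle is the associated bundle with fibre ['cV[R]_8].  As for
    tangent spaces, a spinor at [x] is represented by its components with
    respect to the local spin frame [spin_at x]; [scoord] gives its components
    in any other one. *)
Section Spinors.
Context {M : manifold7 R} {g : M -> E -> E -> R} {gam : 'I_7 -> 'M[R]_8}.
Variable S : spin_structure g gam.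

Definition scoord (i : spin_index S) (x : M) (s : 'cV[R]_8) : 'cV[R]_8 :=
  trans i (spin_at S x) x *m s.

Definition smooth_spinor (eta : M -> 'cV[R]_8) : Prop :=
  forall i, smooth_fun (spin_dom i) (fun x => scoord i x (eta x)).

Definition cmul (x : M) (v : E) (s : 'cV[R]_8) : 'cV[R]_8 :=
  cliff gam (fun a => g x v (frame (spin_at S x) a x)) *m s.

(* Spin(7) acts orthogonally on R^8, so this is the inner product in any
   spin frame. *)
Definition sdot (s t : 'cV[R]_8) : R := (s^T *m t) 0 0.

Definition omul (x : M) (A : R^o * E) (s : 'cV[R]_8) : 'cV[R]_8 :=
  A.1 *: s + cmul x A.2 s.

(* The lift of [nabla] to spinors.  In a local spin frame over an orthonormal
   frame (e_a), v |-> d_v + 1/4 sum_ab g(nabla_v e_a, e_b) gam_a gam_b. *)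
Definition nablaS (nabla : M -> E -> vfield M R -> E) (x : M) (v : E)
    (eta : M -> 'cV[R]_8) : 'cV[R]_8 :=
  let i := spin_at S x in
  tderiv x v (fun y => scoord i y (eta y))
  + 4^-1 *: \sum_a \sum_b
      g x (nabla x v (frame i a)) (frame i b x) *: (gam a *m gam b *m eta x).

Definition phi_spinor (xi : M -> 'cV[R]_8) (x : M) : @kform R 3 := fun v =>
  - sdot (xi x)
      (cmul x (v 0) (cmul x (v 1) (cmul x (v 2) (xi x)))).

Record is_j_map (h : M -> E -> E -> R) (phi : M -> @kform R 3)
    (xi : M -> 'cV[R]_8) (j : (M -> 'cV[R]_8) -> (M -> R^o * E)) : Prop := {
  j_smooth : forall eta, smooth_spinor eta -> smooth_octonion (j eta);
  j_linear : forall (a : R) eta zeta, smooth_spinor eta -> smooth_spinor zeta ->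
    forall x, j (fun y => a *: eta y + zeta y) x = a *: j eta x + j zeta x;
  j_xi : forall x, j xi x = (1, 0);
  j_mul : forall V eta, smooth_octonion V -> smooth_spinor eta ->
    forall x, j (fun y => omul y (V y) (eta y)) x
              = octmul (h x) (phi x) (V x) (j eta x)
}.

End Spinors.
End Spin.

(* Main.v *)
(* At a point, {xi, e_a . xi} is an orthonormal basis of the spinors, so
   eta = A . xi with A = (<xi, eta>, sum_a <e_a . xi, eta> e_a), and
   j_xi eta = A because A is smooth.  The Leibniz rule gives
   nabla^S eta = (nabla A) . xi + A . nabla^S xi, and
   A . (B . xi) = (A o B) . xi, so everything reduces to
   nabla^S_X xi = - T_X . xi.  Since <xi, xi> = 1, nabla^S_X xi = b . xi for
   some vector b.  For a unit vector u, complete u = e_1 to an orthonormal frame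
   in which phi_xi = e^123 + e^145 + e^167 + e^246 - e^257 - e^347 - e^356.
   In this frame the associated metric and volume can be computed: the metric is
   g and vol (e_1, ..., e_7) = 1, so that psi = star phi has psi(t, e_3, e_5, e_7) = g(t, e_1),
   whereas (nabla_X phi)(e_3, e_5, e_7) = - 2 g(b, e_1); hence b = - T_X.
   Smoothness of D_X A uses X(f) = g(nabla_X (f e), e) for unit vector fields e. *)
From Stdlib Require Import ZArith.
Require Import Defs.
From HB Require Import structures.
From mathcomp Require Import all_boot all_order all_algebra all_fingroup.
From mathcomp Require Import all_classical all_reals all_analysis.
From mathcomp Require Import ring lra ssrZ.
(* Importing [Defs] again makes [coord] denote the charts of a manifold rather
   than [vector.coord]. *)
Import Defs.

Set Implicit Arguments.
Unset Strict Implicit.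
Unset Printing Implicit Defensive.

Import Order.TTheory GRing.Theory Num.Theory.
Import numFieldNormedType.Exports.
Local Open Scope classical_set_scope.
Local Open Scope ring_scope.

(** The associated metric is known only through the equation for g(u,v) vol, and j only through its
    rules on smooth sections. So the metric has to be recovered from that equation, and every
    octonion field handed to j needs a smoothness proof. One coefficient of psi suffices for the
    torsion because an adapted frame may start at any unit vector, and e^1357 is the only term of
    psi that contains e^3, e^5 and e^7 together. This avoids the contraction identities between phi
    and psi. The signed sums over permutations behind vol and psi are moved from R to Z, where
    [vm_compute] evaluates them. Derivatives are taken in one spin frame fixed near the point, on
    scalar functions <xi, B eta> with a constant matrix B: B = 1 and B = - gam_a give the components
    of A, a triple product of Clifford matrices gives phi. The Leibniz rule leaves the commutator of
    B with the connection matrix, which accounts for the Levi-Civita derivatives of the vectors that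
    occur in B. *)

Local Notation zr z := ((int_of_Z z)%:~R).

(** * Functions of class C^k *)

(** The differential and the remainder are both zero. This makes differentiability a local property
    in [eq_Ck_on], where the difference of two locally equal functions vanishes near the point. *)
Lemma near0_differentiable {R : realType} {V W : normedModType R}
    (h : V -> W) (x : V) : (\near x, h x = 0) -> differentiable h x.
Proof.
move=> h0; have hx : h x = 0 by exact: (nbhs_singleton h0).
have h0' : \forall y \near (0 : V), h (y + x) = 0.
  by move: h0; rewrite (near_shift 0 x) subr0.
have H : h \o shift x = cst (h x) + (\0 : V -> W) +o_ (0 : V) id.
  apply/eqaddoP => _/posnumP[e]; near=> y.
  have -> : (h \o shift x - (cst (h x) + \0)) y = 0.
    rewrite !fctE /= hx; have -> : h (y + x) = 0 by near: y.
    by rewrite addr0 subr0.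
  by rewrite normr0 mulr_ge0.
have dE : 'd h x = (\0 : {linear V -> W}) :> (V -> W).
  by apply: diff_unique => //; exact: cst_continuous.
apply/diff_locallyP; rewrite dE; split => //; exact: cst_continuous.
Unshelve. all: by end_near. Qed.
Section CkOn.
Context {R : realType} {V : normedModType R}.

Lemma Ck_on_sub (W : normedModType R) k (U U' : set V) (f : V -> W) :
  U' `<=` U -> Ck_on k U f -> Ck_on k U' f.
Proof.
move=> UU'; elim: k f => [|k IH] f /= H; first by move=> x /UU' /H.
by case: H => Hd Hk; split=> [x /UU' /Hd//|v]; apply/IH/Hk.
Qed.

Lemma Ck_on_bigcup (W : normedModType R) k (I : Type) (U : I -> set V)
    (f : V -> W) :
  (forall i, Ck_on k (U i) f) -> Ck_on k (\bigcup_i U i) f.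
Proof.
elim: k f => [|k IH] f /= H; first by move=> x [i _ /H].
by split=> [x [i _ Ux]|v]; [exact: (H i).1|apply: IH => i; exact: (H i).2].
Qed.

Lemma Ck_onS (W : normedModType R) k (U : set V) (f : V -> W) :
  Ck_on k.+1 U f -> Ck_on k U f.
Proof.
elim: k f => [|k IH] f [Hd Hk] /=.
  by move=> x /Hd; exact: differentiable_continuous.
by split=> // v; apply/IH/Hk.
Qed.

Lemma eq_Ck_on (W : normedModType R) k (U : set V) (f f' : V -> W) :
  open U -> (forall x, U x -> f x = f' x) -> Ck_on k U f -> Ck_on k U f'.
Proof.
move=> oU; elim: k f f' => [|k IH] f f' ff'.
  move=> H x Ux; have Hf : f @ x --> f x := H x Ux.
  suff : f' @ x --> f' x by [].
  rewrite -(ff' x Ux); apply: cvg_trans Hf; apply: near_eq_cvg.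
  by apply: filterS (open_nbhs_nbhs (conj oU Ux)) => y /ff'.
case=> Hd Hk; split=> [x Ux|v].
  have -> : f' = f + (f' - f) by rewrite addrC subrK.
  apply: differentiableD; first exact: Hd.
  apply: near0_differentiable.
  apply: filterS (open_nbhs_nbhs (conj oU Ux)) => y /ff' e.
  by rewrite !fctE e subrr.
apply: IH (Hk v) => x Ux; apply: near_eq_derive.
by apply: filterS (open_nbhs_nbhs (conj oU Ux)) => y /ff'.
Qed.

Lemma Ck_onD (W : normedModType R) k (U : set V) (f f' : V -> W) : open U ->
  Ck_on k U f -> Ck_on k U f' -> Ck_on k U (fun x => f x + f' x).
Proof.
move=> oU; elim: k f f' => [|k IH] f f' Hf Hf'.
  by move=> x Ux; exact: continuousD (Hf x Ux) (Hf' x Ux).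
case: Hf Hf' => Hd Hk [Hd' Hk']; split=> [x Ux|v].
  exact: (differentiableD (Hd _ Ux) (Hd' _ Ux)).
apply: eq_Ck_on (IH _ _ (Hk v) (Hk' v)) => // x Ux.
by rewrite -deriveD //; exact/diff_derivable/(Hd _ Ux) || exact/diff_derivable/(Hd' _ Ux).
Qed.

Lemma Ck_onM k (U : set V) (f f' : V -> R) : open U ->
  Ck_on k U f -> Ck_on k U f' -> Ck_on k U (fun x => f x * f' x).
Proof.
move=> oU; elim: k f f' => [|k IH] f f' Hf Hf'.
  by move=> x Ux; exact: continuousM (Hf x Ux) (Hf' x Ux).
have [Hf0 Hf'0] := (Ck_onS Hf, Ck_onS Hf').
case: Hf Hf' => Hd Hk [Hd' Hk']; split=> [x Ux|v].
  exact: (differentiableM (Hd _ Ux) (Hd' _ Ux)).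
apply: eq_Ck_on (Ck_onD oU (IH _ _ Hf0 (Hk' v)) (IH _ _ Hf'0 (Hk v))) => // x Ux.
by rewrite -deriveM //; exact/diff_derivable/(Hd _ Ux) || exact/diff_derivable/(Hd' _ Ux).
Qed.

Lemma derive_linear (W W' : normedModType R) (L : {linear W -> W'}) (f : V -> W)
    x v : continuous L -> differentiable f x ->
  'D_v (L \o f) x = L ('D_v f x).
Proof.
move=> cL df; have dL := linear_differentiable (f x) cL.
rewrite deriveE; last exact: differentiable_comp df dL.
by rewrite (deriveE _ df) (diff_comp df dL) /= diff_lin.
Qed.

Lemma Ck_on_linear (W W' : normedModType R) (L : {linear W -> W'}) k
    (U : set V) (f : V -> W) : open U -> continuous L ->
  Ck_on k U f -> Ck_on k U (fun x => L (f x)).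
Proof.
move=> oU cL; elim: k f => [|k IH] f Hf.
  by move=> x Ux; apply: (continuous_comp (Hf x Ux)); exact: cL.
case: Hf => Hd Hk; split=> [x Ux|v].
  exact: (differentiable_comp (Hd _ Ux) (linear_differentiable (f x) cL)).
apply: eq_Ck_on (IH _ (Hk v)) => // x Ux.
by rewrite -derive_linear //; exact: Hd.
Qed.

Lemma Ck_on_cst (W : normedModType R) k (U : set V) (w : W) :
  Ck_on k U (fun=> w).
Proof.
elim: k w => [|k IH] w; first by move=> x _; exact: cst_continuous.
split=> [x _|v]; first exact: differentiable_cst.
by rewrite (_ : 'D_v _ = fun=> 0) //; apply/funext => x; exact: derive_cst.
Qed.

End CkOn.

(** * Smooth functions and vector fields on a manifold *)

Section SmoothFun.
Context {R : realType} {M : manifold7 R}.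
Local Notation E := 'rV[R]_7.

(** The image consists of the points of the open codomain that the continuous map [param c] sends
    into [U]. *)
Lemma open_coord (U : set M) (c : chart M) :
  open U -> open (coord c @` (U `&` dom c)).
Proof.
move=> oU; rewrite openE => _ [x [Ux cx] <-]; rewrite /interior.
have dx : (coord c @` dom c) (coord c x) by exists x.
have pU : \forall y \near coord c x, U (param c y).
  have pc : param c @ coord c x --> param c (coord c x) := param_continuous dx.
  by apply: pc; rewrite coordK //; exact: open_nbhs_nbhs.
have pd : \forall y \near coord c x, (coord c @` dom c) y.
  by apply: open_nbhs_nbhs; split => //; exact: codom_open.
near=> y; have [z cz zy] : (coord c @` dom c) y by near: y.
have : U (param c y) by near: y.
by rewrite -zy coordK // => Uz; exists z.
Unshelve. all: by end_near. Qed.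

Section Generic.
Context {W : normedModType R}.
Implicit Types F : M -> W.

Lemma smooth_fun_sub (U V : set M) F : V `<=` U -> smooth_fun U F -> smooth_fun V F.
Proof.
by move=> VU UF c k; apply: Ck_on_sub (UF c k); apply: image_subset => x [/VU].
Qed.

Lemma smooth_fun_cover (U : set M) F :
  (forall x, U x -> exists2 V : set M, V x & smooth_fun V F) -> smooth_fun U F.
Proof.
move=> H c k; pose I := {V : set M | smooth_fun V F}.
apply: (@Ck_on_sub _ _ _ _ (\bigcup_(i : I) (coord c @` (sval i `&` dom c)))).
  move=> _ [x [Ux cx] <-]; have [V Vx VF] := H x Ux.
  by exists (exist _ V VF) => //=; exists x.
by apply: Ck_on_bigcup => -[V VF]; exact: VF.
Qed.

Lemma eq_smooth_fun (U : set M) F F' : open U ->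
  (forall x, U x -> F x = F' x) -> smooth_fun U F -> smooth_fun U F'.
Proof.
move=> oU FF' UF c k; apply: eq_Ck_on (UF c k); first exact: open_coord.
by move=> _ [x [Ux cx] <-]; rewrite /= coordK // FF'.
Qed.

Lemma smooth_funD (U : set M) F F' : open U ->
  smooth_fun U F -> smooth_fun U F' -> smooth_fun U (fun x => F x + F' x).
Proof. by move=> oU UF UF' c k; exact: (Ck_onD (open_coord oU) (UF c k) (UF' c k)). Qed.

Lemma smooth_fun_cst (U : set M) (w : W) : smooth_fun U (fun=> w).
Proof. by move=> c k; exact: Ck_on_cst. Qed.

Lemma smooth_fun_sum (I : Type) (r : seq I) (U : set M) (F : I -> M -> W) : open U ->
  (forall i, smooth_fun U (F i)) -> smooth_fun U (fun x => \sum_(i <- r) F i x).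
Proof.
move=> oU UF; elim: r => [|i r IH].
  by apply: eq_smooth_fun (smooth_fun_cst U 0) => // x _; rewrite big_nil.
by apply: eq_smooth_fun (smooth_funD oU (UF i) IH) => // x _; rewrite big_cons.
Qed.

Lemma smooth_fun_linear (W' : normedModType R) (L : W -> W') (U : set M) F :
  open U -> linear L -> continuous L ->
  smooth_fun U F -> smooth_fun U (fun x => L (F x)).
Proof.
move=> oU linL cL UF c k.
pose LM := GRing.isLinear.Build _ _ _ _ _ linL.
pose LL : {linear W -> W'} := HB.pack L LM.
exact: (@Ck_on_linear _ _ _ _ LL _ _ _ (open_coord oU) cL (UF c k)).
Qed.

End Generic.

Lemma smooth_funM (U : set M) (f f' : M -> R) : open U ->
  smooth_fun U f -> smooth_fun U f' -> smooth_fun U (fun x => f x * f' x).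
Proof. by move=> oU UF UF' c k; exact: (Ck_onM (open_coord oU) (UF c k) (UF' c k)). Qed.

Lemma smooth_fun_entry m n (U : set M) (F : M -> 'M[R]_(m.+1, n.+1)) i j : open U ->
  smooth_fun U F -> smooth_fun U (fun x => F x i j : R).
Proof.
move=> oU; apply: (@smooth_fun_linear _ R (fun A : 'M[R]_(m.+1, n.+1) => A i j)) => //.
  by move=> a A B; rewrite !mxE.
exact: matrix_normedtype.coord_continuous.
Qed.

Lemma smooth_fun_scale n (U : set M) (f : M -> R) (F : M -> 'rV[R]_n.+1) : open U ->
  smooth_fun U f -> smooth_fun U F -> smooth_fun U (fun x => f x *: F x).
Proof.
move=> oU Uf UF.
have H (k : 'I_n.+1) : smooth_fun U
    (fun x => (f x * F x 0 k : R) *: (delta_mx 0 k : 'rV[R]_n.+1)).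
  apply: (@smooth_fun_linear R _ (fun t : R => t *: (delta_mx 0 k : 'rV[R]_n.+1))
            _ (fun x => f x * F x 0 k)) => //.
  - by move=> a s t; rewrite scalerDl scalerA.
  - exact: scalel_continuous.
  - by apply: smooth_funM => //; exact: smooth_fun_entry.
apply: eq_smooth_fun (smooth_fun_sum (index_enum 'I_n.+1) oU H) => // x _.
rewrite [in RHS](row_sum_delta (F x)) scaler_sumr.
by apply: eq_bigr => k _; rewrite scalerA.
Qed.

End SmoothFun.

(** * Derivatives along tangent vectors, and smooth vector fields *)

Section Tderiv.
Context {R : realType} {M : manifold7 R}.
Local Notation E := 'rV[R]_7.

Lemma near_param (U : set M) x : open U -> U x ->
  \forall y \near coord (chart_at x) x, U (param (chart_at x) y).
Proof.
move=> oU Ux; have cx := dom_chart_at x.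
have pc : param (chart_at x) @ coord (chart_at x) x
    --> param (chart_at x) (coord (chart_at x) x).
  by apply: param_continuous; exists x.
by apply: pc; rewrite coordK //; exact: open_nbhs_nbhs.
Qed.

Lemma smooth_fun_differentiable (W : normedModType R) (U : set M) (F : M -> W) x :
  smooth_fun U F -> U x ->
  differentiable (F \o param (chart_at x)) (coord (chart_at x) x).
Proof.
move=> UF Ux; have [+ _] := UF (chart_at x) 1%N; apply.
by exists x => //; split => //; exact: dom_chart_at.
Qed.

Lemma eq_tderiv (W : normedModType R) (U : set M) (F F' : M -> W) x v :
  open U -> U x -> (forall y, U y -> F y = F' y) ->
  tderiv x v F = tderiv x v F'.
Proof.
move=> oU Ux FF'; apply: near_eq_derive.
by apply: filterS (near_param oU Ux) => y /FF'.
Qed.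

Lemma tderiv_cst (W : normedModType R) (w : W) (x : M) v : tderiv x v (fun=> w) = 0.
Proof. exact: derive_cst. Qed.

Lemma tderivD (W : normedModType R) (U : set M) (F F' : M -> W) x v : U x ->
  smooth_fun U F -> smooth_fun U F' ->
  tderiv x v (fun y => F y + F' y) = tderiv x v F + tderiv x v F'.
Proof.
move=> Ux UF UF'; apply: deriveD; apply/diff_derivable;
  exact: smooth_fun_differentiable Ux.
Qed.

Lemma tderiv_sum (W : normedModType R) I (r : seq I) (U : set M)
    (F : I -> M -> W) x v : open U -> U x -> (forall i, smooth_fun U (F i)) ->
  tderiv x v (fun y => \sum_(i <- r) F i y) = \sum_(i <- r) tderiv x v (F i).
Proof.
move=> oU Ux UF; elim: r => [|i r IH].
  rewrite big_nil -[RHS](tderiv_cst 0 x v).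
  by apply: (eq_tderiv _ oU Ux) => y _; rewrite big_nil.
rewrite big_cons -IH -(tderivD _ Ux) //; last exact: smooth_fun_sum.
by apply: (eq_tderiv _ oU Ux) => y _; rewrite big_cons.
Qed.

Lemma tderivM (U : set M) (f f' : M -> R) x v : U x ->
  smooth_fun U f -> smooth_fun U f' ->
  tderiv x v (fun y => f y * f' y : R) =
    f x * tderiv x v f' + f' x * tderiv x v f.
Proof.
move=> Ux Uf Uf'; rewrite /tderiv.
have := @deriveM _ _ (f \o param (chart_at x)) (f' \o param (chart_at x))
   (coord (chart_at x) x) v.
rewrite /= coordK; last exact: dom_chart_at.
by apply; apply/diff_derivable; exact: smooth_fun_differentiable Ux.
Qed.

Lemma tderiv_linear (W W' : normedModType R) (L : W -> W') (U : set M)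
    (F : M -> W) x v : U x -> linear L -> continuous L -> smooth_fun U F ->
  tderiv x v (fun y => L (F y)) = L (tderiv x v F).
Proof.
move=> Ux linL cL UF.
pose LM := GRing.isLinear.Build _ _ _ _ _ linL.
pose LL : {linear W -> W'} := HB.pack L LM.
exact: (@derive_linear _ _ _ _ LL _ _ _ cL (smooth_fun_differentiable UF Ux)).
Qed.

Lemma tderiv_entry m n (U : set M) (F : M -> 'M[R]_(m.+1, n.+1)) x v i j :
  U x -> smooth_fun U F ->
  tderiv x v (fun y => F y i j : R) = tderiv x v F i j.
Proof.
move=> Ux; apply: (@tderiv_linear _ R (fun A : 'M[R]_(m.+1, n.+1) => A i j) _ _ _ _ Ux).
  by move=> a A B; rewrite !mxE.
exact: matrix_normedtype.coord_continuous.
Qed.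

Lemma tderivP (W : normedModType R) (U : set M) (F : M -> W) x a u v : U x ->
  smooth_fun U F -> tderiv x (a *: u + v) F = a *: tderiv x u F + tderiv x v F.
Proof.
move=> Ux UF; have dF := smooth_fun_differentiable UF Ux.
by rewrite /tderiv !deriveE // linearP.
Qed.

Lemma smooth_coord (c : chart M) : smooth_fun (dom c) (coord c).
Proof. by move=> d; rewrite setIC; exact: compatible. Qed.

Lemma tcoordP (c : chart M) x a u v : dom c x ->
  tcoord c x (a *: u + v) = a *: tcoord c x u + tcoord c x v.
Proof. by move=> cx; apply: tderivP (@smooth_coord c). Qed.

Lemma tcoord_chart_at (x : M) v : tcoord (chart_at x) x v = v.
Proof.
rewrite /tcoord /tderiv.
have cx := dom_chart_at x.
rewrite -[RHS](derive_id (coord (chart_at x) x) v); apply: near_eq_derive.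
have : \forall y \near coord (chart_at x) x,
    (coord (chart_at x) @` dom (chart_at x)) y.
  by apply: open_nbhs_nbhs; split; [exact: codom_open|exists x].
by apply: filterS => _ [z cz <-] /=; rewrite coordK.
Qed.

(** The components of the chart at [x] are smooth functions whose derivatives are the components of
    the vector. The torsion-free axiom is stated on functions; this turns it into an equation
    between vectors. *)
Lemma tangent_eq (x : M) (u v : E) :
  (forall f : M -> R, smooth_fun_near x f ->
     tderiv x u (f : M -> R^o) = tderiv x v (f : M -> R^o)) -> u = v.
Proof.
move=> H; rewrite -(tcoord_chart_at x u) -(tcoord_chart_at x v).
apply/rowP => k; have sc := @smooth_coord (chart_at x).
have cx := dom_chart_at x.
rewrite /tcoord -!(tderiv_entry _ _ _ cx sc).
apply: (H (fun y => coord (chart_at x) y 0 k)).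
exists (dom (chart_at x)); split => //; first exact: dom_open.
by apply: smooth_fun_entry => //; exact: dom_open.
Qed.

Lemma smooth_vfield_sub (U V : set M) (X : M -> E) :
  V `<=` U -> smooth_vfield U X -> smooth_vfield V X.
Proof.
by move=> VU UX c; apply: smooth_fun_sub (UX c) => x [/VU Ux cx].
Qed.

Lemma smooth_vfield_cover (U : set M) (X : M -> E) :
  (forall x, U x -> exists2 V : set M, V x & smooth_vfield V X) ->
  smooth_vfield U X.
Proof.
move=> H c; apply: smooth_fun_cover => x [/H[V Vx VX] cx].
by exists (V `&` dom c) => //; exact: VX.
Qed.

Lemma eq_smooth_vfield (U : set M) (X X' : M -> E) : open U ->
  (forall x, U x -> X x = X' x) -> smooth_vfield U X -> smooth_vfield U X'.
Proof.
move=> oU XX' UX c; apply: eq_smooth_fun (UX c).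
  by apply: openI => //; exact: dom_open.
by move=> x [/XX' ->].
Qed.

Lemma smooth_vfield_scale (U : set M) (f : M -> R) (X : M -> E) : open U ->
  smooth_fun U f -> smooth_vfield U X -> smooth_vfield U (fun x => f x *: X x).
Proof.
move=> oU Uf UX c; have oUc : open (U `&` dom c).
  by apply: openI => //; exact: dom_open.
have Uf' : smooth_fun (U `&` dom c) f by apply: smooth_fun_sub Uf => x [].
apply: eq_smooth_fun (smooth_fun_scale oUc Uf' (UX c)) => // x [_ cx].
have t0 : tcoord c x 0 = 0.
  have := tcoordP 1 0 0 cx; rewrite !scale1r addr0 => /eqP.
  by rewrite -{1}[tcoord c x 0]addr0 (inj_eq (addrI _)) => /eqP.
by have := tcoordP (f x) (X x) 0 cx; rewrite t0 !addr0.
Qed.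

Lemma smooth_vfieldD (U : set M) (X Y : M -> E) : open U ->
  smooth_vfield U X -> smooth_vfield U Y -> smooth_vfield U (fun x => X x + Y x).
Proof.
move=> oU UX UY c; have oUc : open (U `&` dom c).
  by apply: openI => //; exact: dom_open.
apply: eq_smooth_fun (smooth_funD oUc (UX c) (UY c)) => // x [_ cx].
by have := tcoordP 1 (X x) (Y x) cx; rewrite !scale1r.
Qed.

Lemma smooth_vfield0 (U : set M) : open U -> smooth_vfield U (fun=> 0 : E).
Proof.
move=> oU c; apply: eq_smooth_fun (smooth_fun_cst _ 0).
  by apply: openI => //; exact: dom_open.
move=> x [_ cx]; have := tcoordP 1 0 0 cx; rewrite !scale1r addr0 => /eqP.
by rewrite -{1}[tcoord c x 0]addr0 (inj_eq (addrI _)) => /eqP.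
Qed.

Lemma smooth_vfield_sum (I : Type) (r : seq I) (U : set M) (X : I -> M -> E) :
  open U -> (forall i, smooth_vfield U (X i)) ->
  smooth_vfield U (fun x => \sum_(i <- r) X i x).
Proof.
move=> oU UX; elim: r => [|i r IH].
  by apply: eq_smooth_vfield (smooth_vfield0 oU) => // x _; rewrite big_nil.
by apply: eq_smooth_vfield (smooth_vfieldD oU (UX i) IH) => // x _; rewrite big_cons.
Qed.

End Tderiv.

(** * Sums over permutations *)

Section PermLists.

Definition pseq n (s : 'S_n) : seq nat := [seq val (s i) | i <- enum 'I_n].

(** Permutations as plain lists of values, on which [vm_compute] can work. Prepending [j] and
    bumping the tail is [lift_perm ord0 j] on lists. *)
Fixpoint perm_lists n : seq (seq nat) :=
  if n is n'.+1 then
    flatten [seq [seq j :: map (bump j) l | l <- perm_lists n'] | j <- iota 0 n]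
  else [:: [::]].

Fixpoint odd_inversions (l : seq nat) : bool :=
  if l is x :: t then odd (count (fun y => y < x)%N t) (+) odd_inversions t
  else false.

Lemma pseq_lift n (j : 'I_n.+1) (s : 'S_n) :
  pseq (lift_perm ord0 j s) = val j :: map (bump j) (pseq s).
Proof.
rewrite /pseq enum_ordSl /= lift_perm_id -!map_comp; congr cons.
by apply: eq_map => i /=; rewrite lift_perm_lift.
Qed.

Lemma lift_perm_bij n :
  bijective (fun p : 'I_n.+1 * 'S_n => lift_perm ord0 p.1 p.2).
Proof.
apply: inj_card_bij; last by rewrite card_prod !card_Sn card_ord.
move=> [j s] [j' s'] /= /permP e; have := e ord0; rewrite !lift_perm_id => jj'.
congr (_, _) => //; apply/permP => i.
by have := e (lift ord0 i); rewrite !lift_perm_lift jj' => /lift_inj.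
Qed.

Lemma size_pseq n (s : 'S_n) : size (pseq s) = n.
Proof. by rewrite size_map size_enum_ord. Qed.

Lemma nth_pseq n (s : 'S_n) (i : 'I_n) : nth 0%N (pseq s) i = s i.
Proof.
by rewrite /pseq (nth_map i) ?size_enum_ord // nth_ord_enum.
Qed.

Lemma odd_inversions_bump j l : odd_inversions (map (bump j) l) = odd_inversions l.
Proof.
elim: l => //= x l ->; congr (odd _ (+) _); rewrite count_map; apply: eq_count.
by move=> y /=; rewrite !ltnNge leq_bump2.
Qed.

(** When the first value is [j], exactly [j] later entries are smaller, which matches the parity in
    [odd_lift_perm]; bumping the tail preserves its order. *)
Lemma odd_inversionsE n (s : 'S_n) : odd_inversions (pseq s) = s.
Proof.
elim: n s => [|n IH] s.
  by have -> : s = 1%g; [apply/permP => -[]|rewrite odd_perm1 /pseq enum_ord0].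
have [inv _ invK] := lift_perm_bij n; rewrite -(invK s).
case: (inv s) => j s' /=; rewrite pseq_lift odd_lift_perm /= odd_inversions_bump IH.
congr (_ (+) _); congr odd.
rewrite count_map (_ : count _ _ = count (fun y => y < j)%N (pseq s')).
  have pi : perm_eq (pseq s') (iota 0 n).
    rewrite -val_enum_ord /pseq map_comp; apply: perm_map.
    apply: uniq_perm; rewrite ?enum_uniq //.
      by rewrite (map_inj_uniq (@perm_inj _ s')) enum_uniq.
    by move=> i; rewrite mem_enum -[i](permKV s') map_f // mem_enum.
  rewrite (seq.permP pi) -size_filter.
  rewrite (_ : [seq _ <- _ | _] = iota 0 j) ?size_iota //.
  have jn : (j <= n)%N by rewrite -ltnS.
  rewrite (_ : iota 0 n = iota 0 j ++ iota (0 + j) (n - j)); last first.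
    by rewrite -iotaD subnKC.
  rewrite filter_cat.
  rewrite (@eq_in_filter _ _ predT) ?filter_predT; last first.
    by move=> i; rewrite mem_iota.
  rewrite (@eq_in_filter _ _ pred0) ?filter_pred0 ?cats0 // => i.
  by rewrite mem_iota add0n => /andP[ji _]; rewrite ltnNge ji.
apply: eq_count => y /=; rewrite /bump; case: (leqP j y) => jy.
  by rewrite ltnNge (leq_trans jy).
by rewrite add0n.
Qed.

Lemma sum_perm_lists (R : pzRingType) n (F : seq nat -> R) :
  \sum_(s : 'S_n) F (pseq s) = \sum_(l <- perm_lists n) F l.
Proof.
elim: n F => [|n IH] F.
  rewrite (bigD1 1%g) //= big1 ?addr0 /pseq ?enum_ord0 ?big_seq1 //.
  by move=> s /eqP[]; apply/permP => -[].
have -> : perm_lists n.+1 = flatten [seq [seq j :: map (bump j) l | l <- perm_lists n]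
    | j <- iota 0 n.+1] by [].
rewrite big_flatten big_map -/(index_iota 0 n.+1) big_mkord.
rewrite (reindex _ (onW_bij _ (lift_perm_bij n))) /=.
rewrite -(pair_bigA _ (fun j s => F (pseq (lift_perm ord0 j s)))) /=.
apply: eq_bigr => j _; rewrite big_map -IH.
by apply: eq_bigr => s _; rewrite pseq_lift.
Qed.

Lemma sum_signed_perm (R : pzRingType) n (F : seq nat -> R) :
  \sum_(s : 'S_n) (-1) ^+ (s : bool) * F (pseq s)
  = \sum_(l <- perm_lists n) (-1) ^+ (odd_inversions l) * F l.
Proof.
rewrite -(sum_perm_lists _ (fun l => (-1) ^+ (odd_inversions l) * F l)).
by apply: eq_bigr => s _; rewrite odd_inversionsE.
Qed.

End PermLists.

(** * Integer sums and the octonion multiplication table *)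

Section ZSums.
Context {R : pzRingType}.
Definition zsum (T : Type) (r : seq T) (f : T -> Z) : Z :=
  foldr (fun l => Z.add (f l)) Z0 r.

Lemma zrD a b : zr (Z.add a b) = zr a + zr b :> R.
Proof. by rewrite (raddfD int_of_Z) rmorphD. Qed.

Lemma zrM a b : zr (Z.mul a b) = zr a * zr b :> R.
Proof. by rewrite (rmorphM int_of_Z) rmorphM. Qed.

Lemma zr_sum (T : Type) (r : seq T) (f : T -> Z) :
  \sum_(l <- r) zr (f l) = zr (zsum r f) :> R.
Proof.
by elim: r => [|x r IH]; rewrite ?big_nil ?big_cons //= zrD IH.
Qed.

Definition zsign (b : bool) : Z := if b then Zneg xH else Zpos xH.

Lemma zr_sign b : zr (zsign b) = (-1) ^+ b :> R.
Proof. by case: b; rewrite //= expr1 rmorphN. Qed.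

End ZSums.

Section OctTable.
Local Open Scope Z_scope.

(* The multiplication table of the imaginary octonions for
   phi = e123 + e145 + e167 + e246 - e257 - e347 - e356: the entry in row [i],
   column [j] is [+-(k + 1)] when [e_i e_j = +-e_k], indices starting at 0. *)
Definition oct_table : seq (seq Z) :=
  [:: [::  0;  3; -2;  5; -4;  7; -6];
      [:: -3;  0;  1;  6; -7; -4;  5];
      [::  2; -1;  0; -7; -6;  5;  4];
      [:: -5; -6;  7;  0;  1;  2; -3];
      [::  4;  7;  6; -1;  0; -3; -2];
      [:: -7;  4; -5; -2;  3;  0;  1];
      [::  6; -5; -4;  3;  2; -1;  0]].

Definition oct_entry (b c : nat) : Z := nth 0 (nth [::] oct_table b) c.
Definition oct_sign (b c : nat) : Z := Z.sgn (oct_entry b c).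
(** On the diagonal the entry is 0, so the index defaults to 0; the sign is 0 there, hence [oct_eps]
    vanishes. *)
Definition oct_index (b c : nat) : nat := (Z.abs_nat (oct_entry b c)).-1.

(* phi (e_a, e_b, e_c) *)
Definition oct_eps (a b c : nat) : Z :=
  if a == oct_index b c then oct_sign b c else 0.

End OctTable.

(** * Alternating forms on a 7-dimensional Euclidean space *)

Section Multilinear.
Context {R : realType}.
Local Notation E := 'rV[R]_7.

Definition multilinear k (w : @kform R k) : Prop :=
  forall (i : 'I_k) (v : 'I_k -> E) (a : R) (u u' : E),
    w (fun j => if j == i then a *: u + u' else v j)
    = a * w (fun j => if j == i then u else v j)
      + w (fun j => if j == i then u' else v j).

Lemma affine_sum (f : E -> R) : (forall a u v, f (a *: u + v) = a * f u + f v) ->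
  forall I (r : seq I) (c : I -> R) (b : I -> E),
  f (\sum_(i <- r) c i *: b i) = \sum_(i <- r) c i * f (b i).
Proof.
move=> flin I r c b; have f0 : f 0 = 0.
  have := flin 1 0 0; rewrite scaler0 addr0 mul1r => /eqP.
  by rewrite -subr_eq subrr => /eqP.
elim: r => [|i r IH]; first by rewrite !big_nil.
by rewrite !big_cons flin IH.
Qed.

(** Slots are expanded in the spanning family one at a time; in the induction, all slots from [m] on
    already carry members of [e]. *)
Lemma multilinear_ext k (w1 w2 : @kform R k) (e : 'I_7 -> E) :
  multilinear w1 -> multilinear w2 ->
  (forall v : E, exists c : 'I_7 -> R, v = \sum_i c i *: e i) ->
  (forall h : 'I_k -> 'I_7, w1 (e \o h) = w2 (e \o h)) ->
  forall v, w1 v = w2 v.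
Proof.
move=> l1 l2 span eqb.
suff H m v : (forall i : 'I_k, (m <= i)%N -> exists j, v i = e j) -> w1 v = w2 v.
  by move=> v; apply: (H k) => i; rewrite leqNgt ltn_ord.
elim: m v => [|m IH] v Hv.
  have /choice[h hE] : forall i, exists j, v i = e j by move=> i; exact: Hv.
  by have -> : v = e \o h by apply/funext => i /=.
have [mk|km] := ltnP m k; last first.
  by apply: IH => i mi; have := leq_trans km mi; rewrite leqNgt ltn_ord.
pose i0 := Ordinal mk; have [c vE] := span (v i0).
have -> : v = fun j => if j == i0 then \sum_i c i *: e i else v j.
  by apply/funext => j; case: eqP => // ->.
rewrite (affine_sum (f := fun x => w1 (fun j => if j == i0 then x else v j)));
  last by move=> *; exact: l1.
rewrite (affine_sum (f := fun x => w2 (fun j => if j == i0 then x else v j)));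
  last by move=> *; exact: l2.
apply: eq_bigr => j _; congr (_ * _); apply: IH => i mi.
case: eqP => [_|/eqP ne]; first by exists j.
by apply: Hv; rewrite ltn_neqAle mi andbT; apply: contra ne => /eqP e1; exact/eqP/val_inj.
Qed.

(** Polarization of [W (a + b) (a + b) = 0], where [W a b] has [a] in slot [i] and [b] in slot
    [j]. *)
Lemma kform_swap k (w : @kform R k) (v : 'I_k -> E) (i j : 'I_k) :
  is_kform w -> i != j -> w (v \o tperm i j) = - w v.
Proof.
move=> [lin alt] ij.
pose W a b := w (fun l => if l == i then a else if l == j then b else v l).
have ji : (j == i) = false by apply/negbTE; rewrite eq_sym.
have W0 a : W a a = 0 by apply: (alt i j) => //; rewrite eqxx ji eqxx.
have Wl a b c : W (a + b) c = W a c + W b c.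
  have := lin i (fun l => if l == j then c else v l) 1 a b.
  by rewrite scale1r mul1r.
have Wr a b c : W c (a + b) = W c a + W c b.
  have swp x : W c x = w (fun l => if l == j then x else if l == i then c else v l).
    congr w; apply/funext => l; case: (eqVneq l i) => [->|//].
    by rewrite (negbTE ij).
  have := lin j (fun l => if l == i then c else v l) 1 a b.
  by rewrite scale1r mul1r -!swp.
have WW a b : W b a = - W a b.
  apply/eqP; rewrite -addr_eq0; apply/eqP.
  by have := W0 (a + b); rewrite Wl !Wr !W0 addr0 add0r addrC.
have -> : w (v \o tperm i j) = W (v j) (v i).
  congr w; apply/funext => l /=; case: tpermP => [->|->|/eqP/negbTE-> /eqP/negbTE-> //].
    by rewrite eqxx.
  by rewrite ji eqxx.
rewrite WW; congr (- _); congr w; apply/funext => l.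
by case: eqP => [->//|_]; case: eqP => [->|].
Qed.

Lemma kform_perm k (w : @kform R k) (v : 'I_k -> E) (s : 'S_k) :
  is_kform w -> w (v \o s) = (-1) ^+ (s : bool) * w v.
Proof.
move=> wk; have [ts -> /allP dts] := prod_tpermP s.
elim: ts dts v => [|t ts IH] dts v.
  rewrite big_nil odd_perm1 expr0 mul1r; congr w; apply/funext => i /=.
  by rewrite perm1.
rewrite big_cons.
have -> : v \o (tperm t.1 t.2 * \prod_(t0 <- ts) tperm t0.1 t0.2)%g
    = (v \o (\prod_(t0 <- ts) tperm t0.1 t0.2)%g) \o tperm t.1 t.2.
  by apply/funext => i /=; rewrite permM.
have dt : t.1 != t.2 by exact: (dts t (mem_head _ _)).
rewrite (kform_swap _ wk dt) IH; last by move=> u ut; apply: dts; rewrite inE ut orbT.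
by rewrite odd_permM odd_tperm dt /= signrN mulNr.
Qed.

(** On lists of seven indices below 7 this is the Levi-Civita symbol. *)
Definition sign_list (l : seq nat) : Z :=
  if uniq l then zsign (odd_inversions l) else Z0.

Lemma kform_map (w : @kform R 7) (e : nat -> E) (l : seq nat) :
  is_kform w -> size l = 7%N -> all (fun x => x < 7)%N l ->
  w (fun i => e (nth 0%N l i)) = zr (sign_list l) * w (fun i => e i).
Proof.
move=> wk sl /allP al; rewrite /sign_list; case: ifPn => ul.
  have inj : injective (fun i : 'I_7 => inord (nth 0%N l i) : 'I_7).
    move=> i j /(congr1 val) /=; rewrite !inordK ?al ?mem_nth ?sl // => /eqP.
    by rewrite nth_uniq ?sl // => /eqP /val_inj.
  have val_s i : perm inj i = nth 0%N l i :> nat.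
    by rewrite permE inordK // al // mem_nth ?sl.
  have -> : l = pseq (perm inj).
    apply: (@eq_from_nth _ 0%N); first by rewrite size_pseq.
    by move=> i; rewrite sl => li; rewrite (nth_pseq _ (Ordinal li)) val_s.
  rewrite odd_inversionsE zr_sign -kform_perm //; congr w; apply/funext => i /=.
  by rewrite nth_pseq.
rewrite mul0r; have [i [j [ij eij]]] :
    exists i j : 'I_7, i != j /\ nth 0%N l i = nth 0%N l j.
  apply: contrapT => H; case/negP: ul; apply/(uniqP 0%N) => i j.
  rewrite !inE sl => i7 j7 eij; apply: contrapT => /eqP ij; apply: H.
  by exists (Ordinal i7), (Ordinal j7).
by apply: wk.2 ij _; rewrite /= eij.
Qed.

Lemma args_affine k (w : @kform R k) (s1 s2 : seq E) : multilinear w ->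
  (size s1 < k)%N -> forall a u u',
  w (@args R (s1 ++ (a *: u + u') :: s2) k)
  = a * w (@args R (s1 ++ u :: s2) k) + w (@args R (s1 ++ u' :: s2) k).
Proof.
move=> wl sk a u u'; pose i0 := Ordinal sk.
have H x : @args R (s1 ++ x :: s2) k
    = fun j => if j == i0 then x else @args R (s1 ++ 0 :: s2) k j.
  apply/funext => j; rewrite /args !nth_cat.
  case: eqP => [->|/eqP ne]; first by rewrite ltnn subnn.
  case: ltnP => // sj; case e : (j - size s1)%N => [|m] //.
  by case/eqP: ne; apply: val_inj; apply/eqP; rewrite eqn_leq sj -subn_eq0 e.
by rewrite (H (a *: u + u')) (H u) (H u'); exact: wl.
Qed.

Lemma kform3E (w : @kform R 3) v : w v = w (@args R [:: v ord0; v 1; v 2] 3).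
Proof.
congr w; apply/funext => -[[|[|[|//]]] i3]; rewrite /args /=; congr v; exact: val_inj.
Qed.

End Multilinear.

(** * Orthonormal frames and forms of top degree *)

Section InnerProduct.
Context {R : realType}.
Local Notation E := 'rV[R]_7.

Record inner_product (h : E -> E -> R) : Prop := InnerProduct {
  ip_linear : forall a u v z, h (a *: u + v) z = a * h u z + h v z;
  ip_sym : forall u v, h u v = h v u;
  ip_pos : forall u, u != 0 -> 0 < h u u
}.

Definition orthonormal_frame (h : E -> E -> R) (e : 'I_7 -> E) : Prop :=
  forall i j, h (e i) (e j) = (i == j)%:R.

Context {h : E -> E -> R} (hip : inner_product h).

Lemma ip_linear_r a u v z : h z (a *: u + v) = a * h z u + h z v.
Proof. by rewrite ip_sym // ip_linear // !(ip_sym hip z). Qed.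

Lemma ip0l u : h 0 u = 0.
Proof. by have := ip_linear hip (-1) 0 0 u; rewrite scaler0 addr0 mulN1r addNr. Qed.

Lemma ipZl a u v : h (a *: u) v = a * h u v.
Proof. by have := ip_linear hip a u 0 v; rewrite ip0l !addr0. Qed.

Lemma ipDl u v z : h (u + v) z = h u z + h v z.
Proof. by have := ip_linear hip 1 u v z; rewrite scale1r mul1r. Qed.

Lemma ip0r u : h u 0 = 0.
Proof. by rewrite ip_sym // ip0l. Qed.

Lemma ipZr a u v : h u (a *: v) = a * h u v.
Proof. by rewrite !(ip_sym hip u) ipZl. Qed.

Lemma ipDr u v z : h z (u + v) = h z u + h z v.
Proof. by rewrite !(ip_sym hip z) ipDl. Qed.

Lemma ipNl u v : h (- u) v = - h u v.
Proof. by rewrite -scaleN1r ipZl mulN1r. Qed.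

Lemma ipNr u v : h u (- v) = - h u v.
Proof. by rewrite -scaleN1r ipZr mulN1r. Qed.

Lemma ip_suml I (r : seq I) (c : I -> R) (b : I -> E) v :
  h (\sum_(i <- r) c i *: b i) v = \sum_(i <- r) c i * h (b i) v.
Proof. by apply: (affine_sum (f := h^~ v)) => *; exact: ip_linear. Qed.

Lemma ip_sumr I (r : seq I) (c : I -> R) (b : I -> E) v :
  h v (\sum_(i <- r) c i *: b i) = \sum_(i <- r) c i * h v (b i).
Proof. by apply: (affine_sum (f := h v)) => *; exact: ip_linear_r. Qed.

Lemma ip_eq0 u : h u u = 0 -> u = 0.
Proof.
by move=> u0; apply/eqP; apply: contraT => /(ip_pos hip); rewrite u0 ltxx.
Qed.

Context {e : 'I_7 -> E} (he : orthonormal_frame h e).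

Lemma ip_frame_sum (c : 'I_7 -> R) j : h (\sum_i c i *: e i) (e j) = c j.
Proof.
rewrite ip_suml (bigD1 j) //= he eqxx mulr1 big1 ?addr0 // => i /negbTE ij.
by rewrite he ij mulr0.
Qed.

(** Seven orthonormal vectors are free, hence span; the coefficients are read off by pairing with
    the frame. *)
Lemma orthonormal_expand u : u = \sum_i h u (e i) *: e i.
Proof.
pose A : 'M[R]_7 := \matrix_i e i.
have rowA (c : 'rV_7) : c *m A = \sum_i c 0 i *: e i.
  by rewrite mulmx_sum_row; apply: eq_bigr => i _; rewrite rowK.
have fA : row_free A.
  apply/inj_row_free => c cA; apply/rowP => j; rewrite mxE.
  by rewrite -[LHS](ip_frame_sum (fun i => c 0 i)) -rowA cA ip0l.
have /submxP[c uE] : (u <= A)%MS by rewrite submx_full // row_full_unit -row_free_unit.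
rewrite {1}uE rowA; apply: eq_bigr => i _; congr (_ *: _).
by rewrite uE rowA ip_frame_sum.
Qed.

Lemma ip_parseval u v : h u v = \sum_i h u (e i) * h v (e i).
Proof.
by rewrite {1}(orthonormal_expand u) ip_suml; apply: eq_bigr => i _; rewrite (ip_sym hip v).
Qed.

Lemma ip_frame_inj u v : (forall i, h u (e i) = h v (e i)) -> u = v.
Proof.
move=> uv; rewrite (orthonormal_expand u) (orthonormal_expand v).
by apply: eq_bigr => i _; rewrite uv.
Qed.

(** Both sides are multilinear, so frame vectors are enough: a permutation of the frame gives its
    sign on both sides, and a repeated vector gives zero. *)
Lemma volume_det (w : @kform R 7) v : is_kform w ->
  w v = \det (\matrix_(i, j) h (v i) (e j)) * w e.
Proof.
move=> wk; pose w2 : @kform R 7 := fun v => \det (\matrix_(i, j) h (v i) (e j)) * w e.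
rewrite -[RHS]/(w2 v); apply: (multilinear_ext (e := e)) => [|i0 v' a u u'|u|s].
- by case: wk.
- rewrite /w2 mulrA -mulrDl; congr (_ * _); 
  rewrite -[\det (\matrix_(i, j) h (if i == i0 then u' else _) _)]mul1r.
  apply: (@determinant_multilinear _ _ _ _ _ i0).
  + by apply/rowP => j; rewrite !mxE !eqxx ip_linear // mul1r.
  + by apply/matrixP => i j; rewrite !mxE eq_sym (negbTE (neq_lift _ _)).
  + by apply/matrixP => i j; rewrite !mxE eq_sym (negbTE (neq_lift _ _)).
- by exists (fun i => h u (e i)); exact: orthonormal_expand.
rewrite /w2; have [/injectiveP inj|/injectivePn[i [j ij sij]]] := boolP (injectiveb s).
  have -> : e \o s = e \o perm inj by apply/funext => i /=; rewrite permE.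
  rewrite kform_perm // -det_perm; congr (\det _ * _).
  by apply/matrixP => i j; rewrite !mxE /= he.
rewrite (@determinant_alternate _ _ _ _ _ ij) ?mul0r.
  by apply: wk.2 ij _; rewrite /= sij.
by move=> k; rewrite !mxE /= sij.
Qed.

(** The change of frame is an orthogonal matrix, so its determinant is 1 or -1. *)
Lemma volume_orthonormal (w : @kform R 7) v : is_kform w ->
  orthonormal_frame h v -> `|w v| = `|w e|.
Proof.
move=> wk hv; rewrite (volume_det _ wk) normrM.
set P := \matrix_(i, j) _.
suff /(congr1 determinant) : P *m P^T = 1%:M.
  rewrite det1 det_mulmx det_tr -expr2 => /eqP; rewrite sqrf_eq1.
  by move=> /orP[] /eqP->; rewrite ?normrN normr1 mul1r.
apply/matrixP => i j; rewrite !mxE -hv ip_parseval.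
by apply: eq_bigr => k _; rewrite !mxE.
Qed.

Lemma sharpE (l : E -> R) : (forall a u v, l (a *: u + v) = a * l u + l v) ->
  sharp h l = \sum_i l (e i) *: e i.
Proof.
move=> llin; apply: ip_frame_inj => i; rewrite ip_frame_sum.
by apply: sharpP => //; case: hip.
Qed.

End InnerProduct.

(** * The 7-form of the metric equation in an adapted frame *)

Section G2Volume.
Context {R : realType}.
Local Notation E := 'rV[R]_7.

(** For the model form, [2! * 2!] times the value of the wedge square of e_1 _| phi on the four
    basis vectors listed in [l]. *)
Definition oct_sq_coef (l : seq nat) : Z :=
  zsum (perm_lists 4) (fun m => Z.mul (zsign (odd_inversions m))
    (Z.mul (oct_eps 0 (nth 0%N l (nth 0%N m 0)) (nth 0%N l (nth 0%N m 1)))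
           (oct_eps 0 (nth 0%N l (nth 0%N m 2)) (nth 0%N l (nth 0%N m 3))))).

(** The signed sum over 'S_7 behind the double wedge, without the factorial denominators. Testing
    [c] spares [vm_compute] the inner sum for the four fifths of the 5040 permutations where the
    factor phi vanishes. *)
Definition oct_volume_sum : Z :=
  zsum (perm_lists 7) (fun l =>
    let c := oct_eps (nth 0%N l 4) (nth 0%N l 5) (nth 0%N l 6) in
    if Z.eqb c Z0 then Z0
    else Z.mul (zsign (odd_inversions l)) (Z.mul (oct_sq_coef l) c)).

Lemma oct_volume_sumE :
  oct_volume_sum = Z.mul (Z.of_nat 6) (Z.mul (Z.of_nat (2`! * 2`!))
    (Z.of_nat ((2 + 2)`! * 3`!))).
Proof. by vm_compute. Qed.

Lemma contract3E (phi : @kform R 3) (u : E) (v : 'I_2 -> E) :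
  contract u phi v = phi (@args R [:: u; v 0; v 1] 3).
Proof.
rewrite /contract kform3E; congr (phi (@args R [:: _; _; _] 3)).
- by rewrite unlift_none.
- by rewrite (_ : 1 = lift ord0 0) ?liftK //; exact: val_inj.
- by rewrite (_ : 2 = lift ord0 1) ?liftK //; exact: val_inj.
Qed.

Definition oct_form (phi : @kform R 3) (f : nat -> E) : Prop :=
  forall a b c, (a < 7)%N -> (b < 7)%N -> (c < 7)%N ->
    phi (@args R [:: f a; f b; f c] 3) = zr (oct_eps a b c).

(** The value 6 cancels the 1/6 in the equation of the associated metric, so g(e_1, e_1) vol(e_1,
    ..., e_7) = 1. *)
Lemma wedge_oct_form (phi : @kform R 3) (f : nat -> E) : oct_form phi f ->
  wedge (wedge (contract (f 0%N) phi) (contract (f 0%N) phi)) phi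
    (fun i => f i) = 6.
Proof.
move=> pf.
have W4 (l : seq nat) : (forall i, (i < 4)%N -> (nth 0%N l i < 7)%N) ->
    wedge (contract (f 0%N) phi) (contract (f 0%N) phi)
      (fun i : 'I_(2 + 2) => f (nth 0%N l i)) = 4^-1 * zr (oct_sq_coef l).
  move=> l7; rewrite /wedge; congr (_ * _).
  rewrite -zr_sum.
  pose F m : R := zr (oct_eps 0 (nth 0%N l (nth 0%N m 0)) (nth 0%N l (nth 0%N m 1)))
     * zr (oct_eps 0 (nth 0%N l (nth 0%N m 2)) (nth 0%N l (nth 0%N m 3))).
  transitivity (\sum_(m <- perm_lists 4) (-1) ^+ odd_inversions m * F m); last first.
    by apply: eq_bigr => m _; rewrite /F !zrM zr_sign.
  rewrite -sum_signed_perm; apply: eq_bigr => t _; rewrite -mulrA; congr (_ * _).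
  have tn (i : 'I_4) k : k = i :> nat -> nth 0%N (pseq t) k = t i by move=> ->; rewrite nth_pseq.
  rewrite !contract3E !pf ?l7 // /F.
  rewrite (tn (lshift 2 (0 : 'I_2)) 0%N) // (tn (lshift 2 (1 : 'I_2)) 1%N) //.
  by rewrite (tn (rshift 2 (0 : 'I_2)) 2%N) // (tn (rshift 2 (1 : 'I_2)) 3%N).
rewrite {1}/wedge.
transitivity (((2 + 2)`! * 3`!)%:R^-1 * (4^-1 * zr oct_volume_sum) : R); last first.
  rewrite oct_volume_sumE !zrM.
  have zn n : zr (Z.of_nat n) = n%:R :> R.
    by rewrite (_ : int_of_Z (Z.of_nat n) = n) //; case: n => //= n; rewrite SuccNat2Pos.id_succ.
  rewrite !zn (_ : (2`! * 2`!)%N = 4%N) //.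
  have : ((2 + 2)`! * 3`!)%:R != 0 :> R by rewrite pnatr_eq0.
  by move: (_ `! * _)%:R => a a0; field.
congr (_ * _); rewrite -zr_sum mulr_sumr.
pose F l : R := 4^-1 * zr (oct_sq_coef l) * zr (oct_eps (nth 0%N l 4) (nth 0%N l 5) (nth 0%N l 6)).
transitivity (\sum_(m <- perm_lists 7) (-1) ^+ odd_inversions m * F m); last first.
  apply: eq_bigr => l _; rewrite /F; case: Z.eqb_spec => [->|_].
    by rewrite !mulr0.
  by rewrite !zrM zr_sign; ring.
rewrite -sum_signed_perm; apply: eq_bigr => s _; rewrite -mulrA; congr (_ * _).
have sn (i : 'I_7) k : k = i :> nat -> nth 0%N (pseq s) k = s i by move=> ->; rewrite nth_pseq.
rewrite /F; congr (_ * _).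
  rewrite -W4; last by move=> i i4; rewrite (sn (lshift 3 (Ordinal i4))).
  by congr wedge; apply/funext => i; rewrite (sn (lshift 3 i)).
rewrite kform3E pf //.
rewrite (sn (rshift 4 (0 : 'I_3)) 4%N) // (sn (rshift 4 (1 : 'I_3)) 5%N) //.
by rewrite (sn (rshift 4 (2 : 'I_3)) 6%N).
Qed.

End G2Volume.

(** * The Hodge star in an orthonormal frame *)

Section Hodge.
Context {R : realType}.
Local Notation E := 'rV[R]_7.
Context {h : E -> E -> R} (hip : inner_product h).

(** Pairing a basis with its dual basis gives the inverse metric, whatever the basis; an orthonormal
    frame is its own dual. *)
Lemma edual_frame (e : 'I_7 -> E) (B : E -> E -> R) : orthonormal_frame h e ->
  (forall y a u v, B (a *: u + v) y = a * B u y + B v y) ->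
  (forall y a u v, B y (a *: u + v) = a * B y u + B y v) ->
  \sum_i B (ebase i) (edual h i) = \sum_a B (e a) (e a).
Proof.
move=> he Bl Br.
transitivity (\sum_i \sum_a h (ebase i) (e a) * B (e a) (edual h i)).
  apply: eq_bigr => i _; rewrite {1}(orthonormal_expand hip he (ebase i)).
  exact: (affine_sum (Bl _)).
rewrite exchange_big; apply: eq_bigr => a _.
rewrite -(affine_sum (Br _)); congr B.
rewrite -[LHS]/(sharp h (h^~ (e a))) (sharpE hip he).
  by rewrite [RHS](orthonormal_expand hip he); apply: eq_bigr => i _; rewrite (ip_sym hip).
by move=> *; exact: ip_linear.
Qed.

Lemma sum_ffun3 n (F : 'I_n.+1 -> 'I_n.+1 -> 'I_n.+1 -> R) :
  \sum_(f : {ffun 'I_3 -> 'I_n.+1}) F (f 0) (f 1) (f 2)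
  = \sum_i \sum_j \sum_k F i j k.
Proof.
rewrite [RHS](eq_bigr (fun i => \sum_p F i p.1 p.2)); last first.
  by move=> i _; rewrite pair_bigA.
rewrite pair_bigA /=.
rewrite (reindex (fun p : 'I_n.+1 * ('I_n.+1 * 'I_n.+1) =>
  [ffun i : 'I_3 => nth ord0 [:: p.1; p.2.1; p.2.2] i])).
  by apply: eq_bigr => p _; rewrite !ffunE.
exists (fun f : {ffun 'I_3 -> 'I_n.+1} => (f 0, (f 1, f 2))) => [[i [j k]] _|f _].
  by rewrite !ffunE.
apply/ffunP => -[[|[|[|//]]] i3]; rewrite ffunE /=; congr (f _); exact: val_inj.
Qed.

Lemma hodge_frame (e : 'I_7 -> E) (phi : @kform R 3) (vol : @kform R 7)
    (v : 'I_4 -> E) : orthonormal_frame h e -> multilinear phi -> multilinear vol ->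
  @hodge R 3 4 h vol phi v = 6^-1 * \sum_i \sum_j \sum_k
    phi (@args R [:: e i; e j; e k] 3)
    * vol (@args R [:: e i; e j; e k; v 0; v 1; v 2; v 3] 7).
Proof.
move=> he lphi lvol; rewrite /hodge; congr (_ * _).
pose K x x' y y' z z' : R := phi (@args R [:: x; y; z] 3)
    * vol (@args R [:: x'; y'; z'; v 0; v 1; v 2; v 3] 7).
transitivity (\sum_i \sum_j \sum_k K (ebase i) (edual h i) (ebase j) (edual h j)
    (ebase k) (edual h k)).
  rewrite -sum_ffun3; apply: eq_bigr => f _; rewrite kform3E /K; congr (_ * vol _).
  apply/funext => i; rewrite /args.
  case: splitP => [[[|[|[|//]]] j3]|[[|[|[|[|//]]]] j3]] /= -> /=;
    by [congr (edual h (f _)); exact: val_inj|congr v; exact: val_inj].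
have p0 y z := args_affine (s1 := [::]) [:: y; z] lphi isT.
have p1 x z := args_affine (s1 := [:: x]) [:: z] lphi isT.
have p2 x y := args_affine (s1 := [:: x; y]) [::] lphi isT.
have v0 y z := args_affine (s1 := [::]) [:: y; z; v 0; v 1; v 2; v 3] lvol isT.
have v1 x z := args_affine (s1 := [:: x]) [:: z; v 0; v 1; v 2; v 3] lvol isT.
have v2 x y := args_affine (s1 := [:: x; y]) [:: v 0; v 1; v 2; v 3] lvol isT.
simpl in p0, p1, p2, v0, v1, v2.
rewrite (edual_frame (e := e) (B := fun x x' => \sum_j \sum_k
   K x x' (ebase j) (edual h j) (ebase k) (edual h k))) //; last first.
- move=> x a u u'; rewrite mulr_sumr -big_split; apply: eq_bigr => j _.
  rewrite mulr_sumr -big_split; apply: eq_bigr => k _.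
  by rewrite /K v0 /=; ring.
- move=> x a u u'; rewrite mulr_sumr -big_split; apply: eq_bigr => j _.
  rewrite mulr_sumr -big_split; apply: eq_bigr => k _.
  by rewrite /K p0 /=; ring.
apply: eq_bigr => i _.
rewrite (edual_frame (e := e) (B := fun y y' => \sum_k
   K (e i) (e i) y y' (ebase k) (edual h k))) //; last first.
- move=> x a u u'; rewrite mulr_sumr -big_split; apply: eq_bigr => k _.
  by rewrite /K v1 /=; ring.
- move=> x a u u'; rewrite mulr_sumr -big_split; apply: eq_bigr => k _.
  by rewrite /K p1 /=; ring.
apply: eq_bigr => j _.
rewrite (edual_frame (e := e) (B := fun z z' => K (e i) (e i) (e j) (e j) z z')) //.
- by move=> x a u u'; rewrite /K p2; ring.
- by move=> x a u u'; rewrite /K v2; ring.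
Qed.

(** For the model form, 3! times psi(e_d, e_2, e_4, e_6), with indices starting at 0. *)
Definition oct_hodge_coef (d : nat) : Z :=
  zsum (iota 0 7) (fun i => zsum (iota 0 7) (fun j => zsum (iota 0 7) (fun k =>
    let c := oct_eps i j k in
    if Z.eqb c Z0 then Z0
    else Z.mul c (sign_list [:: i; j; k; d; 2; 4; 6]%N)))).

Lemma oct_hodge_coefE d : (d < 7)%N ->
  oct_hodge_coef d = if d == 0%N then Z.of_nat 6 else Z0.
Proof. by do 7![case: d => [_|d]; first by vm_compute]. Qed.

Lemma sum_ord_iota n (F : nat -> R) : \sum_(i < n) F i = \sum_(i <- iota 0 n) F i.
Proof. by rewrite -(big_mkord xpredT) /index_iota subn0. Qed.

Lemma hodge_oct_form (phi : @kform R 3) (vol : @kform R 7) (f : nat -> E) t :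
  multilinear phi -> is_kform vol -> oct_form phi f ->
  orthonormal_frame h (fun i => f i) -> vol (fun i => f i) = 1 ->
  @hodge R 3 4 h vol phi (@args R [:: t; f 2%N; f 4%N; f 6%N] 4) = h t (f 0%N).
Proof.
move=> lphi kvol pf hf vol1.
rewrite (hodge_frame _ hf lphi kvol.1).
have volE (i j k : 'I_7) :
    vol (@args R [:: f i; f j; f k; t; f 2%N; f 4%N; f 6%N] 7)
    = \sum_(d < 7) h t (f d)
        * zr (sign_list [:: (i : nat); (j : nat); (k : nat); (d : nat); 2; 4; 6]%N).
  have v3 := args_affine (s1 := [:: f i; f j; f k]) [:: f 2%N; f 4%N; f 6%N] kvol.1 isT.
  rewrite {1}(orthonormal_expand hip hf t) (affine_sum v3).
  apply: eq_bigr => d _; congr (_ * _).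
  have := kform_map (l := [:: (i : nat); (j : nat); (k : nat); (d : nat); 2; 4; 6]%N)
    f kvol erefl.
  rewrite vol1 mulr1 => <- /=; last by rewrite !ltn_ord.
  by congr vol; apply/funext => -[[|[|[|[|[|[|[|//]]]]]]] l7].
transitivity (6^-1 * \sum_(d < 7) h t (f d) * zr (oct_hodge_coef d)); last first.
  rewrite (bigD1 ord0) // big1 => [|d /negbTE d0]; last first.
    by rewrite oct_hodge_coefE // (_ : (d == 0%N :> nat) = (d == ord0)) // d0 mulr0.
  rewrite oct_hodge_coefE // [ord0 == 0%N :> nat]eqxx.
  by rewrite [_ _ 0]addr0 (_ : zr (Z.of_nat 6) = 6 :> R) //; field.
congr (_ * _).
transitivity (\sum_(i < 7) \sum_(j < 7) \sum_(k < 7) \sum_(d < 7) h t (f d) *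
   (zr (oct_eps i j k)
    * zr (sign_list [:: (i : nat); (j : nat); (k : nat); (d : nat); 2; 4; 6]%N))).
  apply: eq_bigr => i _; apply: eq_bigr => j _; apply: eq_bigr => k _.
  by rewrite pf // volE mulr_sumr; apply: eq_bigr => d _; rewrite mulrCA.
under eq_bigr => i _ do (under eq_bigr => j _ do rewrite exchange_big; rewrite exchange_big).
rewrite exchange_big; apply: eq_bigr => d _.
under eq_bigr => i _ do (under eq_bigr => j _ do rewrite -mulr_sumr; rewrite -mulr_sumr).
rewrite -mulr_sumr; congr (_ * _).
rewrite /oct_hodge_coef -zr_sum -sum_ord_iota; apply: eq_bigr => i _.
rewrite -zr_sum -sum_ord_iota; apply: eq_bigr => j _.
rewrite -zr_sum -sum_ord_iota.
apply: eq_bigr => k _; case: Z.eqb_spec => [->|_]; first by rewrite mul0r.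
by rewrite zrM.
Qed.

End Hodge.

(** * Clifford multiplication and adapted frames *)

Section Sdot.
Context {R : realType}.
Implicit Types s t : 'cV[R]_8.

Lemma sdotE s t : sdot s t = \sum_k s k 0 * t k 0.
Proof. by rewrite /sdot mxE; apply: eq_bigr => k _; rewrite mxE. Qed.

Lemma sdotC s t : sdot s t = sdot t s.
Proof. by rewrite !sdotE; apply: eq_bigr => k _; rewrite mulrC. Qed.

Lemma sdotDr s t t' : sdot s (t + t') = sdot s t + sdot s t'.
Proof. by rewrite /sdot mulmxDr mxE. Qed.

Lemma sdotZr a s t : sdot s (a *: t) = a * sdot s t.
Proof. by rewrite /sdot -scalemxAr mxE. Qed.

Lemma sdotNr s t : sdot s (- t) = - sdot s t.
Proof. by rewrite -scaleN1r sdotZr mulN1r. Qed.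

Lemma sdotDl s s' t : sdot (s + s') t = sdot s t + sdot s' t.
Proof. by rewrite !(sdotC _ t) sdotDr. Qed.

Lemma sdotZl a s t : sdot (a *: s) t = a * sdot s t.
Proof. by rewrite !(sdotC _ t) sdotZr. Qed.

Lemma sdotNl s t : sdot (- s) t = - sdot s t.
Proof. by rewrite !(sdotC _ t) sdotNr. Qed.

Lemma sdot_adjoint (A : 'M[R]_8) s t : sdot (A *m s) t = sdot s (A^T *m t).
Proof. by rewrite /sdot trmx_mul mulmxA. Qed.

End Sdot.

Section Clifford.
Context {R : realType}.
Local Notation E := 'rV[R]_7.

(** Clifford multiplication at a point, detached from any frame; every spin frame supplies an
    instance. *)
Record clifford_action (h : E -> E -> R) (G : E -> 'M[R]_8) : Prop := {
  cl_linear : forall a u v, G (a *: u + v) = a *: G u + G v;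
  cl_skew : forall u, (G u)^T = - G u;
  cl_anticomm : forall u v, G u *m G v + G v *m G u = (- 2 * h u v)%:M
}.

Context {h : E -> E -> R} (hip : inner_product h).
Context {G : E -> 'M[R]_8} (hG : clifford_action h G).

Lemma cl0 : G 0 = 0.
Proof.
have := cl_linear hG 1 0 0; rewrite !scale1r addr0 => /eqP.
by rewrite -{1}[G 0]addr0 (inj_eq (addrI _)) => /eqP.
Qed.

Lemma clZ a u : G (a *: u) = a *: G u.
Proof. by have := cl_linear hG a u 0; rewrite cl0 !addr0. Qed.

Lemma clN u : G (- u) = - G u.
Proof. by rewrite -scaleN1r clZ scaleN1r. Qed.

Lemma cl_sum I (r : seq I) (c : I -> R) (b : I -> E) :
  G (\sum_(i <- r) c i *: b i) = \sum_(i <- r) c i *: G (b i).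
Proof.
elim: r => [|i r IH]; first by rewrite !big_nil cl0.
by rewrite !big_cons (cl_linear hG) IH.
Qed.

Lemma cl_adj u s t : sdot (G u *m s) t = - sdot s (G u *m t).
Proof. by rewrite sdot_adjoint (cl_skew hG) mulNmx sdotNr. Qed.

Lemma cl_swap u v (s : 'cV[R]_8) :
  G u *m (G v *m s) = - (G v *m (G u *m s)) - (2 * h u v) *: s.
Proof.
have := congr1 (mulmx^~ s) (cl_anticomm hG u v).
rewrite mul_scalar_mx mulmxDl -!mulmxA => e.
by rewrite -[LHS](addrK (G v *m (G u *m s))) e mulNr scaleNr addrC.
Qed.

Lemma cl_anti u v (s : 'cV[R]_8) : h u v = 0 ->
  G u *m (G v *m s) = - (G v *m (G u *m s)).
Proof. by move=> uv; rewrite cl_swap uv mulr0 scale0r subr0. Qed.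

Lemma cl_sq u (s : 'cV[R]_8) : G u *m (G u *m s) = - (h u u *: s).
Proof.
have e := cl_swap u u s; have : 2 *: (G u *m (G u *m s)) = 2 *: - (h u u *: s).
  by rewrite scaler_nat mulr2n {1}e addrAC addNr add0r scalerN scalerA.
by move/(scalerI (_ : 2 != 0 :> R)); apply; rewrite pnatr_eq0.
Qed.

Lemma sdot_cl u s : sdot s (G u *m s) = 0.
Proof.
by have := cl_adj u s s; rewrite sdotC; lra.
Qed.

(** Pair the Clifford relation with [s] and use skew-adjointness. For a unit spinor, v |-> v . xi is
    therefore an isometry. *)
Lemma sdot_cl_cl u v s : sdot (G u *m s) (G v *m s) = h u v * sdot s s.
Proof.
have := congr1 (sdot s) (cl_swap u v s); rewrite sdotDr !sdotNr sdotZr.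
have := cl_adj u s (G v *m s); have := cl_adj v s (G u *m s).
by rewrite (sdotC (G v *m s)); lra.
Qed.

Context {xi : 'cV[R]_8} (xi1 : sdot xi xi = 1).

Lemma sdot_cl_unit u v : sdot (G u *m xi) (G v *m xi) = h u v.
Proof. by rewrite sdot_cl_cl xi1 mulr1. Qed.

(* The vector part of j_xi. *)
Definition spinor_vec (s : 'cV[R]_8) : E := sharp h (fun v => sdot (G v *m xi) s).

Lemma spinor_vecP s v : h (spinor_vec s) v = sdot (G v *m xi) s.
Proof.
apply: sharpP => [*|*|*|*]; [exact: ip_linear|exact: ip_sym|exact: ip_pos|].
by rewrite (cl_linear hG) mulmxDl -scalemxAl sdotDl sdotZl.
Qed.

Context {e : 'I_7 -> E} (he : orthonormal_frame h e).

(** The rows of [A] are xi and the e_a . xi, eight orthonormal vectors of R^8. So A A^T = 1, and A^T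
    A = 1 expresses their completeness. *)
Lemma spinor_expand s : s = sdot xi s *: xi + G (spinor_vec s) *m xi.
Proof.
pose b (i : 'I_8) := if unlift ord0 i is Some a then G (e a) *m xi else xi.
have b0 : b ord0 = xi by rewrite /b unlift_none.
have bl a : b (lift ord0 a) = G (e a) *m xi by rewrite /b liftK.
pose A : 'M[R]_8 := \matrix_(i, j) b i j 0.
have : A *m A^T = 1%:M.
  apply/matrixP => i j; rewrite !mxE.
  have -> : \sum_k A i k * A^T k j = sdot (b i) (b j).
    by rewrite sdotE; apply: eq_bigr => k _; rewrite !mxE.
  case: (unliftP ord0 i) => [a|] ->; case: (unliftP ord0 j) => [a'|] ->;
    rewrite ?b0 ?bl ?sdot_cl_unit ?xi1 ?sdot_cl //.
  by rewrite sdotC sdot_cl.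
move/mulmx1C => AA.
have {1}-> : s = \sum_i sdot (b i) s *: b i.
  rewrite -[LHS]mul1mx -AA -mulmxA; apply/colP => k; rewrite mxE summxE.
  apply: eq_bigr => i _; rewrite !mxE mulrC; congr (_ * _).
  by rewrite sdotE; apply: eq_bigr => l _; rewrite !mxE.
rewrite big_ord_recl b0; congr (_ + _).
rewrite [spinor_vec s](orthonormal_expand hip he) cl_sum mulmx_suml.
by apply: eq_bigr => a _; rewrite bl -scalemxAl spinor_vecP.
Qed.

(** The cross product of phi_xi, read off from the Clifford action. *)
Definition spinor_cross u v : E := spinor_vec (G u *m (G v *m xi)).

Lemma cl_cl u v :
  G u *m (G v *m xi) = - (h u v *: xi) + G (spinor_cross u v) *m xi.
Proof.
rewrite {1}[G u *m _]spinor_expand; congr (_ + _); rewrite -scaleNr; congr (_ *: _).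
by rewrite -[LHS]opprK -cl_adj sdot_cl_unit.
Qed.

Lemma cl_crossE u v : h u v = 0 -> G u *m (G v *m xi) = G (spinor_cross u v) *m xi.
Proof. by move=> uv; rewrite cl_cl uv scale0r oppr0 add0r. Qed.

(** Fewer than seven linear conditions leave a nonzero solution, which is then normalized. *)
Lemma exists_unit_orthogonal (l : seq E) : (size l < 7)%N ->
  exists q, h q q = 1 /\ forall v, v \in l -> h q v = 0.
Proof.
move=> l7; pose A : 'M[R]_(7, size l) := \matrix_(a, k) h (e a) (nth 0 l k).
have : kermx A != 0.
  by rewrite -mxrank_eq0 mxrank_ker subn_eq0 -ltnNge (leq_ltn_trans (rank_leq_col A)).
move/rowV0Pn => [c /sub_kermxP cA c0].
pose q := \sum_a c 0 a *: e a.
have q0 : q != 0.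
  apply: contra c0 => /eqP q0; apply/eqP/rowP => a; rewrite mxE.
  by rewrite -(ip_frame_sum hip he (fun a => c 0 a)) -/q q0 ip0l.
have qq := ip_pos hip q0.
exists ((Num.sqrt (h q q))^-1 *: q); split=> [|v /(nthP 0)[k kl <-]].
  rewrite ipZl // ipZr // mulrA -invfM -expr2 sqr_sqrtr ?ltW // mulVf //.
  exact: lt0r_neq0.
rewrite ipZl // (_ : h q (nth 0 l k) = 0) ?mulr0 //.
have /rowP/(_ (Ordinal kl)) := cA; rewrite !mxE => cAk.
by rewrite -[RHS]cAk /q ip_suml //; apply: eq_bigr => a _; rewrite !mxE.
Qed.

Definition oct_frame (f : nat -> E) : Prop :=
  (forall i j, (i < 7)%N -> (j < 7)%N -> h (f i) (f j) = (i == j)%:R) /\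
  (forall b c, (b < 7)%N -> (c < 7)%N -> b != c ->
     G (f b) *m (G (f c) *m xi)
     = zr (oct_sign b c) *: (G (f (oct_index b c)) *m xi)).

(** On a line of the Fano plane one product determines the other five, because unit vectors square
    to -1 and orthogonal vectors anticommute. *)
Lemma oct_line p q r :
  h p p = 1 -> h q q = 1 -> h p q = 0 -> h p r = 0 -> h q r = 0 ->
  G p *m (G q *m xi) = G r *m xi ->
  [/\ G p *m (G q *m xi) = G r *m xi,
      G q *m (G r *m xi) = G p *m xi,
      G r *m (G p *m xi) = G q *m xi
    & [/\ G q *m (G p *m xi) = - (G r *m xi),
          G r *m (G q *m xi) = - (G p *m xi)
        & G p *m (G r *m xi) = - (G q *m xi)]].
Proof.
move=> pp qq pq pr qr pqr.
have qrE : G q *m (G r *m xi) = G p *m xi.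
  rewrite -pqr cl_swap (ip_sym hip q p) pq mulr0 scale0r subr0 cl_sq qq scale1r.
  by rewrite mulmxN opprK.
have prE : G p *m (G r *m xi) = - (G q *m xi) by rewrite -pqr cl_sq pp scale1r.
split=> //; first by rewrite cl_anti 1?ip_sym // prE opprK.
split=> //; first by rewrite cl_anti 1?ip_sym // pqr.
by rewrite cl_anti 1?ip_sym // qrE.
Qed.

(** Besides [u], only [p] orthogonal to [u] and [q] orthogonal to [u], [p], u x p are chosen; the
    other four vectors are cross products. In the order u, p, r, q, s, t, w, numbered from 0, [mij]
    is the product of members i and j. Four of the seven Fano lines hold by construction, three
    follow by anticommuting. *)
Lemma exists_oct_frame u : h u u = 1 -> exists f, f 0%N = u /\ oct_frame f.
Proof.
move=> uu.
have [|p [pp /(_ u) pu]] := @exists_unit_orthogonal [:: u]; first by [].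
have {}pu : h p u = 0 by apply: pu; rewrite inE.
have up : h u p = 0 by rewrite ip_sym.
pose r := spinor_cross u p; have upr : G u *m (G p *m xi) = G r *m xi by exact: cl_crossE.
have [|q [qq qv]] := @exists_unit_orthogonal [:: u; p; r]; first by [].
have qu : h q u = 0 by apply: qv; rewrite !inE eqxx.
have qp : h q p = 0 by apply: qv; rewrite !inE eqxx ?orbT.
have qr : h q r = 0 by apply: qv; rewrite !inE eqxx ?orbT.
have uq : h u q = 0 by rewrite ip_sym.
have pq : h p q = 0 by rewrite ip_sym.
have rq : h r q = 0 by rewrite ip_sym.
pose s := spinor_cross u q; have uqs : G u *m (G q *m xi) = G s *m xi by exact: cl_crossE.
pose t := spinor_cross p q; have pqt : G p *m (G q *m xi) = G t *m xi by exact: cl_crossE.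
pose w := spinor_cross q r; have qrw : G q *m (G r *m xi) = G w *m xi by exact: cl_crossE.
(* A product is orthogonal to its factors ([prodl], [prodr]), is a unit for unit factors ([prodn]),
   and multiplying two orthogonal vectors by a common factor keeps them orthogonal ([prodll],
   [prodrr]). *)
have prodl a b c : G a *m (G b *m xi) = G c *m xi -> h a c = 0.
  move=> abc; rewrite -sdot_cl_unit -abc; rewrite cl_adj cl_sq.
  by rewrite sdotNr opprK sdotZr sdot_cl mulr0.
have prodr a b c : h a b = 0 -> G a *m (G b *m xi) = G c *m xi -> h b c = 0.
  move=> ab abc; rewrite -[h b c]opprK -ipNr // (prodl b a (- c)) ?oppr0 //.
  by rewrite clN mulNmx -abc cl_anti // ip_sym.
have prodn a b c : h a a = 1 -> h b b = 1 -> G a *m (G b *m xi) = G c *m xi -> h c c = 1.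
  by move=> aa bb abc; rewrite -sdot_cl_unit -abc sdot_cl_cl sdot_cl_unit aa bb mulr1.
have prodll a b b' c c' : G a *m (G b *m xi) = G c *m xi ->
    G a *m (G b' *m xi) = G c' *m xi -> h a a = 1 -> h b b' = 0 -> h c c' = 0.
  move=> abc abc' aa bb; rewrite -sdot_cl_unit -abc -abc' cl_adj cl_sq aa scale1r.
  by rewrite sdotNr opprK sdot_cl_unit.
have prodrr a a' b c c' : G a *m (G b *m xi) = G c *m xi ->
    G a' *m (G b *m xi) = G c' *m xi -> h a a' = 0 -> h c c' = 0.
  by move=> abc abc' aa; rewrite -sdot_cl_unit -abc -abc' sdot_cl_cl aa mul0r.
have ur := prodl _ _ _ upr; have pr := prodr _ _ _ up upr; have rr := prodn _ _ _ uu pp upr.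
have [m01 m12 m20 [m10 m21 m02]] := oct_line uu pp up ur pr upr.
have us := prodl _ _ _ uqs; have qs := prodr _ _ _ uq uqs; have ss := prodn _ _ _ uu qq uqs.
have [m03 m34 m40 [m30 m43 m04]] := oct_line uu qq uq us qs uqs.
have pt := prodl _ _ _ pqt; have qt := prodr _ _ _ pq pqt; have tt := prodn _ _ _ pp qq pqt.
have [m13 m35 m51 [m31 m53 m15]] := oct_line pp qq pq pt qt pqt.
have qw := prodl _ _ _ qrw; have rw_ := prodr _ _ _ qr qrw; have ww := prodn _ _ _ qq rr qrw.
have [m32 m26 m63 [m23 m62 m36]] := oct_line qq rr qr qw rw_ qrw.
have ngN a b c : G a *m (G b *m xi) = - (G c *m xi) -> G a *m (G b *m xi) = G (- c) *m xi.
  by rewrite clN mulNmx.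
(* Each remaining scalar product is between two products that share a factor; products with a minus
   sign enter through [ngN]. *)
have rs : h r s = 0 by exact: prodll _ _ _ _ _ m01 m03 uu pq.
have ps : h p s = 0.
  rewrite -[h p s]opprK -ipNl //.
  by rewrite (prodll _ _ _ _ _ (ngN _ _ _ m02) m03 uu rq) oppr0.
have ut : h u t = 0 by exact: prodll _ _ _ _ _ m12 m13 pp rq.
have rt : h r t = 0.
  rewrite -[h r t]opprK -ipNl //.
  by rewrite (prodll _ _ _ _ _ (ngN _ _ _ m10) m13 pp uq) oppr0.
have st : h s t = 0 by exact: prodrr _ _ _ _ _ m03 m13 up.
have uw : h u w = 0.
  rewrite -[h u w]opprK -ipNr // -ipNl //.
  exact: prodll _ _ _ _ _ (ngN _ _ _ m21) (ngN _ _ _ m23) rr pq.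
have pw : h p w = 0.
  rewrite -[h p w]opprK -ipNr //.
  by rewrite (prodll _ _ _ _ _ m20 (ngN _ _ _ m23) rr uq) oppr0.
have sw : h s w = 0.
  rewrite -[h s w]opprK -ipNr //.
  by rewrite (prodrr _ _ _ _ _ m03 (ngN _ _ _ m23) ur) oppr0.
have tw : h t w = 0.
  rewrite -[h t w]opprK -ipNr //.
  by rewrite (prodrr _ _ _ _ _ m13 (ngN _ _ _ m23) pr) oppr0.
(* Acting on xi: u.t = u.p.q = - u.q.p = q.u.p = q.r = w. The other two lines are found in the same
   way. *)
have utw : G u *m (G t *m xi) = G w *m xi.
  by rewrite -m13 (cl_anti xi pq) mulmxN (cl_anti _ uq) opprK m01 m32.
have [m05 m56 m60 [m50 m65 m06]] := oct_line uu tt ut uw tw utw.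
have sp : h s p = 0 by rewrite ip_sym.
have spw : G s *m (G p *m xi) = G w *m xi.
  by rewrite (cl_anti xi sp) -m03 (cl_anti _ pu) opprK m13 m05.
have [m41 m16 m64 [m14 m61 m46]] := oct_line ss pp sp sw pw spw.
have sr : h s r = 0 by rewrite ip_sym.
have ru : h r u = 0 by rewrite ip_sym.
have srt : G s *m (G r *m xi) = G t *m xi.
  by rewrite (cl_anti xi sr) -m03 (cl_anti _ ru) opprK m23 mulmxN m06 opprK.
have [m42 m25 m54 [m24 m52 m45]] := oct_line ss rr sr st rt srt.
exists (nth 0 [:: u; p; r; q; s; t; w]); split=> //; split.
  move=> i j i7 j7.
  by case: i i7 => [|[|[|[|[|[|[|//]]]]]]] _; case: j j7 => [|[|[|[|[|[|[|//]]]]]]] _ //=;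
    first [assumption | by rewrite ip_sym].
have pos (x y : 'cV[R]_8) : x = y -> x = 1%:~R *: y by rewrite scale1r.
have neg (x y : 'cV[R]_8) : x = - y -> x = (-1)%:~R *: y by rewrite scaleN1r.
move=> b c b7 c7 bc; move: b b7 bc => [|[|[|[|[|[|[|//]]]]]]] _ bc.
- by move: c c7 bc => [|[|[|[|[|[|[|//]]]]]]] c7 bc;
    [by [] | exact: pos m01 | exact: neg m02 | exact: pos m03
    | exact: neg m04 | exact: pos m05 | exact: neg m06].
- by move: c c7 bc => [|[|[|[|[|[|[|//]]]]]]] c7 bc;
    [exact: neg m10 | by [] | exact: pos m12 | exact: pos m13
    | exact: neg m14 | exact: neg m15 | exact: pos m16].
- by move: c c7 bc => [|[|[|[|[|[|[|//]]]]]]] c7 bc;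
    [exact: pos m20 | exact: neg m21 | by [] | exact: neg m23
    | exact: neg m24 | exact: pos m25 | exact: pos m26].
- by move: c c7 bc => [|[|[|[|[|[|[|//]]]]]]] c7 bc;
    [exact: neg m30 | exact: neg m31 | exact: pos m32 | by []
    | exact: pos m34 | exact: pos m35 | exact: neg m36].
- by move: c c7 bc => [|[|[|[|[|[|[|//]]]]]]] c7 bc;
    [exact: pos m40 | exact: pos m41 | exact: pos m42 | exact: neg m43
    | by [] | exact: neg m45 | exact: neg m46].
- by move: c c7 bc => [|[|[|[|[|[|[|//]]]]]]] c7 bc;
    [exact: neg m50 | exact: pos m51 | exact: neg m52 | exact: neg m53
    | exact: pos m54 | by [] | exact: pos m56].
- by move: c c7 bc => [|[|[|[|[|[|[|//]]]]]]] c7 bc;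
    [exact: pos m60 | exact: neg m61 | exact: neg m62 | exact: pos m63
    | exact: pos m64 | exact: neg m65 | by []].
Qed.

Lemma oct_frame_expand f (b c : nat) s : oct_frame f -> (b < 7)%N -> (c < 7)%N ->
  b != c -> sdot (G s *m xi) (G (f b) *m (G (f c) *m xi))
   = zr (oct_sign b c) * h s (f (oct_index b c)).
Proof. by move=> [_ fm] b7 c7 bc; rewrite fm // sdotZr sdot_cl_unit. Qed.

End Clifford.

(** * Recovering the metric from the volume equation *)

Section MetricOfVolume.
Context {R : realType}.
Local Notation E := 'rV[R]_7.

Lemma ip_polarization (g : E -> E -> R) u v : inner_product g ->
  g u v = (g (u + v) (u + v) - g u u - g v v) / 2.
Proof.
by move=> ip; rewrite !(ipDl, ipDr) // (ip_sym ip v u); field.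
Qed.

(* Since [`|vol|] takes the same value [c] on all [g]-orthonormal frames, [k] is
   [c^-1 g]; rescaling a [g]-orthonormal frame then shows that [sqrt c ^+ 9 = 1]. *)
Lemma metric_of_volume (g k : E -> E -> R) (vol : @kform R 7) (e : 'I_7 -> E) :
  inner_product g -> inner_product k -> orthonormal_frame g e ->
  is_volume_of k vol ->
  (forall u, g u u = 1 -> exists f : 'I_7 -> E,
     orthonormal_frame g f /\ k u u * vol f = 1) ->
  forall u v, k u v = g u v.
Proof.
move=> gip kip ge [kvol volk] H.
pose c := `|vol e|.
have kc u : g u u = 1 -> k u u * c = 1.
  move=> uu; have [f [gf kf]] := H u uu.
  have kpos : 0 < k u u.
    apply: (ip_pos kip); apply/eqP => u0; move: uu.
    by rewrite u0 ip0l // => /eqP; rewrite eq_sym oner_eq0.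
  have vf : 0 < vol f by rewrite -(pmulr_rgt0 _ kpos) kf ltr01.
  by rewrite /c -(volume_orthonormal gip ge kvol gf) gtr0_norm.
have c0 : 0 < c.
  have := kc (e ord0); rewrite ge eqxx => /(_ erefl) e0.
  rewrite lt_def normr_ge0 andbT; apply/eqP => c0.
  by move: e0; rewrite c0 mulr0 => /eqP; rewrite eq_sym oner_eq0.
have kg u : k u u * c = g u u.
  have [->|u0] := eqVneq u 0; first by rewrite !ip0l // mul0r.
  have gu := ip_pos gip u0; have gu' := lt0r_neq0 gu.
  pose s := (Num.sqrt (g u u))^-1.
  have ss : s ^+ 2 * g u u = 1 by rewrite /s exprVn sqr_sqrtr ?ltW // mulVf.
  have := kc (s *: u); rewrite !ipZl // !ipZr // !mulrA -!expr2 ss => /(_ erefl) e1.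
  have s0 : s ^+ 2 != 0.
    by apply/eqP => s0; move: ss; rewrite s0 mul0r => /eqP; rewrite eq_sym oner_eq0.
  by apply: (mulfI s0); rewrite mulrA ss.
have kgc u v : k u v * c = g u v.
  by rewrite (ip_polarization _ _ gip) (ip_polarization _ _ kip) -!kg; field.
pose t := Num.sqrt c.
have t0 : 0 <= t by exact: sqrtr_ge0.
have tc : t ^+ 2 = c by rewrite sqr_sqrtr // ltW.
have : `|vol (fun i => t *: e i)| = 1.
  apply: volk => i j; rewrite ipZl // ipZr // mulrA -expr2 tc mulrC kgc.
  exact: ge.
rewrite (volume_det gip ge _ kvol).
have -> : \matrix_(i, j) g (t *: e i) (e j) = t%:M.
  by apply/matrixP => i j; rewrite !mxE ipZl // ge mulr_natr.
rewrite det_scalar normrM normrX (ger0_norm t0) -/c -tc -exprD => /eqP.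
rewrite pexpr_eq1 // => /eqP t1.
by move=> u v; rewrite -kgc -tc t1 expr1n mulr1.
Qed.

End MetricOfVolume.

(** * The 3-form of a unit spinor at a point *)

Section SpinorForm.
Context {R : realType}.
Local Notation E := 'rV[R]_7.
Context {h : E -> E -> R} (hip : inner_product h).
Context {G : E -> 'M[R]_8} (hG : clifford_action h G).
Context {xi : 'cV[R]_8} (xi1 : sdot xi xi = 1).

Definition spinor_form : @kform R 3 := fun v =>
  - sdot xi (G (v 0) *m (G (v 1) *m (G (v 2) *m xi))).

Lemma spinor_form_multilinear : multilinear spinor_form.
Proof.
move=> i v a u u'; rewrite /spinor_form.
case: i => -[|[|[|//]]] i3; rewrite -!(inj_eq val_inj) /=.
- by rewrite (cl_linear hG) mulmxDl -scalemxAl sdotDr sdotZr opprD mulrN.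
- by rewrite (cl_linear hG) mulmxDl -scalemxAl mulmxDr -scalemxAr sdotDr sdotZr opprD mulrN.
- by rewrite (cl_linear hG) mulmxDl -scalemxAl !mulmxDr -!scalemxAr sdotDr sdotZr opprD mulrN.
Qed.

Lemma spinor_formE a b c : spinor_form (@args R [:: a; b; c] 3)
  = sdot (G a *m xi) (G b *m (G c *m xi)).
Proof. by rewrite /spinor_form /args /= -(cl_adj hG). Qed.

Lemma oct_index_lt b c : (b < 7)%N -> (c < 7)%N -> (oct_index b c < 7)%N.
Proof. by do 7![case: b => [|b] //; first by do 7![case: c => [|c] //]]. Qed.

Lemma oct_eps_diag a b : (b < 7)%N -> oct_eps a b b = Z0.
Proof. by rewrite /oct_eps; do 7![case: b => [|b] //; first by case: ifP]. Qed.

Lemma oct_frame_form f : @oct_frame R h G xi f -> oct_form spinor_form f.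
Proof.
move=> ff a b c a7 b7 c7; rewrite spinor_formE.
have [->|bc] := eqVneq b c.
  rewrite (cl_sq hG) oct_eps_diag // sdotNr sdotZr sdotC (sdot_cl hG).
  by rewrite mulr0 oppr0.
rewrite (oct_frame_expand hG xi1) // ff.1 ?oct_index_lt // /oct_eps.
by case: eqP; rewrite ?mulr1 ?mulr0.
Qed.

End SpinorForm.

(** * Spin frames and the spinorial connection *)

Section CliffordRep.
Context {R : realType} {gam : 'I_7 -> 'M[R]_8} (Hgam : clifford_rep gam).

Lemma cliff_skew u : (cliff gam u)^T = - cliff gam u.
Proof.
rewrite /cliff raddf_sum /= -sumrN; apply: eq_bigr => a _.
by rewrite linearZ /= Hgam.1 scalerN.
Qed.

Lemma cliff_anticomm u v :
  cliff gam u *m cliff gam v + cliff gam v *m cliff gam u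
  = (- 2 * \sum_a u a * v a)%:M.
Proof.
have mulE p q : cliff gam p *m cliff gam q
    = \sum_a \sum_b (p a * q b) *: (gam a *m gam b).
  rewrite /cliff mulmx_suml; apply: eq_bigr => a _; rewrite mulmx_sumr.
  by apply: eq_bigr => b _; rewrite -scalemxAl -scalemxAr scalerA.
rewrite !mulE [X in _ + X]exchange_big -big_split mulr_sumr raddf_sum /=.
apply: eq_bigr => a _; rewrite -big_split /= (bigD1 a) //= big1 => [|b ba].
  by rewrite [v a * _]mulrC -scalerDr Hgam.2 eqxx mulr1 addr0 scale_scalar_mx mulrC.
by rewrite [v b * _]mulrC -scalerDr Hgam.2 eq_sym (negbTE ba) mulr0 raddf0 scaler0.
Qed.

Lemma cliff_sq u : cliff gam u *m cliff gam u = (- \sum_a u a ^+ 2)%:M.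
Proof.
have H := cliff_anticomm u u.
have : 2 *: (cliff gam u *m cliff gam u) = 2 *: (- \sum_a u a ^+ 2)%:M.
  rewrite scaler_nat mulr2n H scale_scalar_mx; congr (_%:M); rewrite mulNr mulrN.
  by congr (- (_ * _)); apply: eq_bigr => a _; rewrite expr2.
by apply: scalerI; rewrite pnatr_eq0.
Qed.

Lemma spin7_orthogonal p : spin7 gam p -> p^T *m p = 1%:M.
Proof.
elim=> [|u v q u1 v1 _ IH]; first by rewrite trmx1 mulmx1.
have unit w : \sum_a w a ^+ 2 = 1 -> (cliff gam w)^T *m cliff gam w = 1%:M.
  by move=> w1; rewrite cliff_skew mulNmx cliff_sq w1 -raddfN /= opprK.
rewrite !trmx_mul -!mulmxA (mulmxA _ _ (cliff gam v *m q)) unit // mul1mx.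
by rewrite (mulmxA _ _ q) unit // mul1mx.
Qed.

End CliffordRep.

Section SpinFrames.
Context {R : realType} {M : manifold7 R}.
Local Notation E := 'rV[R]_7.
Context {g : M -> E -> E -> R} (Hg : riemannian_metric g).
Context {gam : 'I_7 -> 'M[R]_8} (Hgam : clifford_rep gam).
Context {S : spin_structure g gam}.

Lemma riemannian_inner_product x : inner_product (g x).
Proof. by case: Hg => -[gl _ _] gs gp; split=> *; [exact: gl|exact: gs|exact: gp]. Qed.
Local Notation ip := riemannian_inner_product.

Lemma frame_onb (i : spin_index S) x : spin_dom i x ->
  orthonormal_frame (g x) (fun a => frame i a x).
Proof. by move=> ix a b; exact: frame_orthonormal. Qed.

Definition frame_cliff (i : spin_index S) (x : M) (v : E) : 'M[R]_8 :=
  cliff gam (fun a => g x v (frame i a x)).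

Lemma frame_cliff_action i x : spin_dom i x ->
  clifford_action (g x) (frame_cliff i x).
Proof.
move=> ix; split=> [a u v|u|u v].
- rewrite /frame_cliff /cliff scaler_sumr -big_split; apply: eq_bigr => b _.
  by rewrite (ip_linear (ip x)) scalerDl scalerA.
- exact: cliff_skew.
- by rewrite cliff_anticomm // -(ip_parseval (ip x) (frame_onb ix)).
Qed.

Lemma frame_cliff_frame i x a : spin_dom i x -> frame_cliff i x (frame i a x) = gam a.
Proof.
move=> ix; rewrite /frame_cliff /cliff (bigD1 a) //= frame_orthonormal // eqxx scale1r.
by rewrite big1 ?addr0 // => b ba; rewrite frame_orthonormal // eq_sym (negbTE ba) scale0r.
Qed.

Lemma trans_orthogonal (i j : spin_index S) x : spin_dom i x -> spin_dom j x ->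
  (trans i j x)^T *m trans i j x = 1%:M.
Proof. by move=> ix jx; apply: (spin7_orthogonal Hgam); exact: trans_spin. Qed.

(** It is idempotent by the cocycle condition and invertible because it is orthogonal. *)
Lemma trans_id (i : spin_index S) x : spin_dom i x -> trans i i x = 1%:M.
Proof.
move=> ix; have := congr1 (mulmx (trans i i x)^T) (trans_cocycle ix ix ix).
by rewrite mulmxA trans_orthogonal // mul1mx.
Qed.

(** [frame_trans] gives this on frame vectors, and linearity does the rest. It makes Clifford
    multiplication, which [cmul] computes in the frame [spin_at], the same in every spin frame. *)
Lemma trans_frame_cliff i j x v : spin_dom i x -> spin_dom j x ->
  trans i j x *m frame_cliff j x v = frame_cliff i x v *m trans i j x.
Proof.
move=> ix jx; have tu : trans i j x \in unitmx.
  by have /mulmx1_unit[] := trans_orthogonal ix jx.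
have tg a : trans i j x *m gam a
    = frame_cliff i x (frame j a x) *m trans i j x.
  by rewrite /frame_cliff -frame_trans // mulmxKV.
rewrite {2}(orthonormal_expand (ip x) (frame_onb jx) v) (cl_sum (frame_cliff_action ix)).
rewrite {1}/frame_cliff /cliff mulmx_sumr mulmx_suml; apply: eq_bigr => a _.
by rewrite -scalemxAl -scalemxAr tg.
Qed.

Lemma sdot_scoord (i : spin_index S) (x : M) s t : spin_dom i x ->
  sdot (scoord i x s) (scoord i x t) = sdot s t.
Proof.
move=> ix; rewrite /scoord sdot_adjoint mulmxA trans_orthogonal ?mul1mx //.
exact: spin_dom_at.
Qed.

Lemma scoord_cmul (i : spin_index S) (x : M) v s : spin_dom i x ->
  scoord i x (cmul S x v s) = frame_cliff i x v *m scoord i x s.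
Proof.
move=> ix; rewrite /scoord /cmul mulmxA -/(frame_cliff _ x v) trans_frame_cliff ?mulmxA //.
exact: spin_dom_at.
Qed.

Lemma scoord_at (x : M) s : scoord (spin_at S x) x s = s.
Proof. by rewrite /scoord trans_id ?mul1mx //; exact: spin_dom_at. Qed.

(** [phi_spinor] uses at each point the frame chosen by [spin_at], which may jump from point to
    point; differentiating phi requires a single frame on an open set. *)
Lemma phi_spinorE (xi : M -> 'cV[R]_8) (i : spin_index S) (x : M) : spin_dom i x ->
  phi_spinor S xi x
  = spinor_form (G := frame_cliff i x) (xi := scoord i x (xi x)).
Proof.
move=> ix; apply/funext => v; rewrite /phi_spinor /spinor_form -(sdot_scoord _ _ ix).
by rewrite !scoord_cmul.
Qed.

(* [j_xi eta] *)
Definition spinor_oct (xi eta : M -> 'cV[R]_8) (y : M) : R^o * E :=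
  (sdot (xi y) (eta y),
   spinor_vec (h := g y) (G := frame_cliff (spin_at S y) y) (xi := xi y) (eta y)).

Lemma omul_spinor_oct xi eta y : sdot (xi y) (xi y) = 1 ->
  omul S y (spinor_oct xi eta y) (xi y) = eta y.
Proof.
move=> y1; have iy := spin_dom_at S y.
by rewrite [RHS](spinor_expand (ip y) (frame_cliff_action iy) y1 (frame_onb iy)).
Qed.

End SpinFrames.

(** * Differentiating inner products of spinors *)

Section SdotCalculus.
Context {R : realType} {M : manifold7 R}.
Implicit Types F H : M -> 'cV[R]_8.

Lemma sdot_mulmxE (B : 'M[R]_8) (s t : 'cV[R]_8) :
  sdot s (B *m t) = \sum_k \sum_l (s k 0 * t l 0) * B k l.
Proof.
rewrite sdotE; apply: eq_bigr => k _; rewrite mxE mulr_sumr.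
by apply: eq_bigr => l _; ring.
Qed.

Let smooth_term (U : set M) F H (B : 'M[R]_8) k l : open U ->
  smooth_fun U F -> smooth_fun U H ->
  smooth_fun U (fun y => (F y k 0 * H y l 0) * B k l : R).
Proof.
move=> oU UF UH; apply: smooth_funM => //; last exact: smooth_fun_cst.
by apply: smooth_funM => //; exact: smooth_fun_entry.
Qed.

Lemma smooth_sdot (U : set M) F H (B : 'M[R]_8) : open U ->
  smooth_fun U F -> smooth_fun U H ->
  smooth_fun U (fun y => sdot (F y) (B *m H y) : R).
Proof.
move=> oU UF UH.
apply: (@eq_smooth_fun _ _ _ _ (fun y => \sum_k \sum_l (F y k 0 * H y l 0) * B k l : R)) => //.
  by move=> y _; rewrite sdot_mulmxE.
by do 2![apply: smooth_fun_sum => // ?]; exact: smooth_term.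
Qed.

(** A constant [B] is enough: in a spin frame, Clifford multiplication by a field with constant
    frame coefficients is a constant matrix. *)
Lemma tderiv_sdot (U : set M) F H (B : 'M[R]_8) x v : open U -> U x ->
  smooth_fun U F -> smooth_fun U H ->
  tderiv x v (fun y => sdot (F y) (B *m H y) : R)
  = sdot (tderiv x v F) (B *m H x) + sdot (F x) (B *m tderiv x v H).
Proof.
move=> oU Ux UF UH.
rewrite (@eq_tderiv _ _ _ _ _ (fun y => \sum_k \sum_l (F y k 0 * H y l 0) * B k l : R) _ _ oU Ux);
  last by move=> y _; rewrite sdot_mulmxE.
rewrite !sdot_mulmxE (tderiv_sum _ _ oU Ux); last first.
  by move=> k; apply: smooth_fun_sum => // l; exact: smooth_term.
rewrite -big_split; apply: eq_bigr => k _.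
rewrite (tderiv_sum _ _ oU Ux); last by move=> l; exact: smooth_term.
rewrite -big_split; apply: eq_bigr => l _ /=.
have UFk : smooth_fun U (fun y => F y k 0 : R) by exact: smooth_fun_entry.
have UHl : smooth_fun U (fun y => H y l 0 : R) by exact: smooth_fun_entry.
rewrite (tderivM _ Ux (smooth_funM oU UFk UHl) (smooth_fun_cst _ _)).
rewrite tderiv_cst (tderivM _ Ux UFk UHl) (tderiv_entry _ _ _ Ux UF) (tderiv_entry _ _ _ Ux UH).
by rewrite mulr0 add0r; ring.
Qed.

End SdotCalculus.

(** * The connection matrix on spinors *)

Section SpinConnection.
Context {R : realType} {gam : 'I_7 -> 'M[R]_8} (Hgam : clifford_rep gam).
Variable (w : 'I_7 -> 'I_7 -> R).
Hypothesis w_skew : forall a b, w a b = - w b a.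

(** The lift of the skew matrix [w] to the Lie algebra of Spin(7), acting on spinors. *)
Definition spin_conn : 'M[R]_8 :=
  4^-1 *: \sum_a \sum_b w a b *: (gam a *m gam b).

Lemma spin_conn_skew : spin_conn^T = - spin_conn.
Proof.
have e : \sum_a \sum_b w a b *: (gam a *m gam b)
    = \sum_a \sum_b w b a *: (gam b *m gam a) by exact: exchange_big.
rewrite /spin_conn linearZ -scalerN; congr (_ *: _); rewrite {1}e.
rewrite raddf_sum -sumrN; apply: eq_bigr => a _.
rewrite raddf_sum -sumrN; apply: eq_bigr => b _ /=.
by rewrite linearZ /= trmx_mul !Hgam.1 mulNmx mulmxN opprK w_skew scaleNr.
Qed.

(** The bracket with the lift acts on vectors through [w]. Moving gam_c across gam_a gam_b leaves a
    multiple of gam_a and one of gam_b; by skewness each sums to twice the claimed value, which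
    accounts for the 1/4. *)
Lemma spin_conn_comm p :
  spin_conn *m cliff gam p - cliff gam p *m spin_conn
  = cliff gam (fun b => \sum_a p a * w a b).
Proof.
have gamC a b c : gam a *m gam b *m gam c - gam c *m (gam a *m gam b)
    = (- 2 * (b == c)%:R) *: gam a - (- 2 * (a == c)%:R) *: gam b.
  have := congr1 (mulmx (gam a)) (Hgam.2 b c).
  have := congr1 (mulmx^~ (gam b)) (Hgam.2 a c).
  rewrite /= mulmxDl mulmxDr mul_scalar_mx mul_mx_scalar !mulmxA => <- <-.
  by rewrite opprD addrA addrK.
have comm c : spin_conn *m gam c - gam c *m spin_conn = \sum_b w c b *: gam b.
  rewrite /spin_conn -scalemxAl -scalemxAr -scalerBr mulmx_suml mulmx_sumr -sumrB.
  rewrite (eq_bigr (fun a => \sum_b (w a b * (- 2 * (b == c)%:R)) *: gam a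
      - \sum_b (w a b * (- 2 * (a == c)%:R)) *: gam b)); last first.
    move=> a _; rewrite mulmx_suml mulmx_sumr -!sumrB; apply: eq_bigr => b _.
    by rewrite -scalemxAl -scalemxAr -scalerBr gamC scalerBr !scalerA.
  rewrite sumrB.
  have -> : \sum_a \sum_b (w a b * (- 2 * (b == c)%:R)) *: gam a
      = 2 *: \sum_b w c b *: gam b.
    rewrite scaler_sumr; apply: eq_bigr => a _.
    rewrite (bigD1 c) //= eqxx mulr1 big1 ?addr0 => [|b /negbTE->]; last by rewrite !mulr0 scale0r.
    by rewrite scalerA w_skew; congr (_ *: _); ring.
  have -> : \sum_a \sum_b (w a b * (- 2 * (a == c)%:R)) *: gam b
      = - (2 *: \sum_b w c b *: gam b).
    rewrite (bigD1 c) //= eqxx mulr1 [X in _ + X]big1 ?addr0 => [|a /negbTE->]; last first.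
      by rewrite big1 // => b _; rewrite !mulr0 scale0r.
    rewrite scaler_sumr -sumrN; apply: eq_bigr => b _.
    by rewrite scalerA -scaleNr; congr (_ *: _); ring.
  by rewrite opprK -scalerDl scalerA (_ : 4^-1 * (2 + 2) = 1 :> R) ?scale1r //; field.
rewrite /cliff mulmx_sumr mulmx_suml -sumrB.
rewrite (eq_bigr (fun c => \sum_b (p c * w c b) *: gam b)); last first.
  move=> c _; rewrite -scalemxAr -scalemxAl -scalerBr comm scaler_sumr.
  by apply: eq_bigr => b _; rewrite scalerA.
by rewrite exchange_big; apply: eq_bigr => b _; rewrite scaler_suml.
Qed.

End SpinConnection.

(** * The Levi-Civita connection and its spinor lift in a spin frame *)

Section SpinGeometry.
Context {R : realType} {M : manifold7 R}.
Local Notation E := 'rV[R]_7.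
Context {g : M -> E -> E -> R} (Hg : riemannian_metric g).
Context {gam : 'I_7 -> 'M[R]_8} (Hgam : clifford_rep gam).
Context {S : spin_structure g gam}.
Local Notation ip := (riemannian_inner_product Hg).

(** Every tangent vector at a point of [spin_dom i] extends to such a field, whose Clifford matrix
    in the frame [i] is constant. *)
Definition frame_field (i : spin_index S) (p : 'I_7 -> R) (y : M) : E :=
  \sum_a p a *: frame i a y.

Lemma smooth_frame_field i p : smooth_vfield (spin_dom i) (frame_field i p).
Proof.
have oi := spin_dom_open i; apply: smooth_vfield_sum => // a.
by apply: smooth_vfield_scale => //; [exact: smooth_fun_cst|exact: frame_smooth].
Qed.

Lemma smooth_frame_field_near (i : spin_index S) p x : spin_dom i x ->
  smooth_vfield_near x (frame_field i p).
Proof.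
by move=> ix; exists (spin_dom i); split => //; [exact: spin_dom_open|exact: smooth_frame_field].
Qed.

Lemma smooth_frame_near i a x : spin_dom i x -> smooth_vfield_near x (@frame _ _ _ _ S i a).
Proof.
by move=> ix; exists (spin_dom i); split => //; [exact: spin_dom_open|exact: frame_smooth].
Qed.

Lemma frame_field_ip (i : spin_index S) p x a : spin_dom i x ->
  g x (frame_field i p x) (frame i a x) = p a.
Proof. by move=> ix; rewrite (ip_frame_sum (ip x) (frame_onb ix)). Qed.

Lemma frame_cliff_field (i : spin_index S) p x : spin_dom i x ->
  frame_cliff i x (frame_field i p x) = cliff gam p.
Proof. by move=> ix; apply: eq_bigr => a _; rewrite frame_field_ip. Qed.

Lemma frame_field_expand (i : spin_index S) x v : spin_dom i x ->
  v = frame_field i (fun a => g x v (frame i a x)) x.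
Proof. by move=> ix; rewrite {1}(orthonormal_expand (ip x) (frame_onb ix) v). Qed.

Lemma tensor2_smooth_fun (t : M -> E -> E -> R) (U : set M) X Y : tensor2 t ->
  open U -> smooth_vfield U X -> smooth_vfield U Y ->
  smooth_fun U (fun x => t x (X x) (Y x) : R).
Proof. by case=> _ _; apply. Qed.

(** The difference D(X, Y) is symmetric in X and Y since torsion vanishes, and g(D(X, Y), Z) is skew
    in Y and Z by metricity. Alternating these symmetries three times each returns to the start with
    the opposite sign. *)
Lemma levi_civita_unique n1 n2 : levi_civita g n1 -> levi_civita g n2 ->
  forall x v Y, smooth_vfield_near x Y -> n1 x v Y = n2 x v Y.
Proof.
move=> l1 l2 x v Y sY; pose D v Y := n1 x v Y - n2 x v Y.
suff : D v Y = 0 by move=> /eqP; rewrite subr_eq0 => /eqP.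
have Dsym X Z : smooth_vfield_near x X -> smooth_vfield_near x Z ->
    D (X x) Z = D (Z x) X.
  move=> sX sZ.
  suff e : n1 x (X x) Z - n1 x (Z x) X = n2 x (X x) Z - n2 x (Z x) X.
    rewrite /D -[n1 x (X x) Z](subrK (n1 x (Z x) X)) e addrAC.
    by rewrite [_ - _ - _]addrAC subrr add0r addrC.
  apply: tangent_eq => f sf.
  exact: etrans (nabla_torsion_free l1 sX sZ sf) (esym (nabla_torsion_free l2 sX sZ sf)).
have Dskew u X Z : smooth_vfield_near x X -> smooth_vfield_near x Z ->
    g x (D u X) (Z x) = - g x (D u Z) (X x).
  move=> sX sZ.
  have := nabla_metric l1 u sX sZ; rewrite (nabla_metric l2 u sX sZ).
  rewrite /D !(ipDl (ip x)) !(ipNl (ip x)) (ip_sym (ip x) _ (n1 _ _ _)).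
  by rewrite (ip_sym (ip x) _ (n2 _ _ _)); lra.
have ix := spin_dom_at S x; set i := spin_at S x in ix.
rewrite (frame_field_expand v ix); set p := fun a => _.
apply: (ip_frame_inj (ip x) (frame_onb ix)) => a; rewrite (ip0l (ip x)).
have sX := smooth_frame_field_near p ix; have sZ := @smooth_frame_near i a x ix.
have := Dskew (frame_field i p x) _ _ sY sZ.
rewrite (Dsym _ _ sX sZ) (Dskew _ _ _ sX sY) (Dsym _ _ sZ sY) opprK.
rewrite (Dskew _ _ _ sZ sX) (Dsym _ _ sY sX) => e.
by move: e; lra.
Qed.

Section Connection.
Context {nabla : M -> E -> (M -> E) -> E} (Hnabla : levi_civita g nabla).

Definition conn_coef (i : spin_index S) x v a b : R :=
  g x (nabla x v (frame i a)) (frame i b x).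

Lemma tderiv_frame_const (i : spin_index S) x v (f : M -> R) c : spin_dom i x ->
  (forall y, spin_dom i y -> f y = c) -> tderiv x v (f : M -> R^o) = 0.
Proof.
move=> ix fc; rewrite -[RHS](@tderiv_cst _ _ R^o c x v).
by apply: (eq_tderiv _ (spin_dom_open i) ix) => y /fc.
Qed.

Lemma conn_coef_skew (i : spin_index S) x v a b : spin_dom i x ->
  conn_coef i x v a b = - conn_coef i x v b a.
Proof.
move=> ix.
have := nabla_metric Hnabla v (smooth_frame_near a ix) (smooth_frame_near b ix).
rewrite (@tderiv_frame_const i x v _ (a == b)%:R) //; last first.
  by move=> y iy; exact: frame_orthonormal.
rewrite [X in _ = _ + X](ip_sym (ip x)) /conn_coef; lra.
Qed.

Lemma nabla_frame_coord (i : spin_index S) x v Y a : spin_dom i x -> smooth_vfield_near x Y ->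
  g x (nabla x v Y) (frame i a x)
  = tderiv x v (fun y => g y (Y y) (frame i a y) : R^o)
    - \sum_b g x (Y x) (frame i b x) * conn_coef i x v a b.
Proof.
move=> ix sY; rewrite (nabla_metric Hnabla v sY (smooth_frame_near a ix)).
by rewrite -(ip_parseval (ip x) (frame_onb ix)) addrK.
Qed.

(** The right-hand side is the commutator of [spin_conn_comm]; together they say that Clifford
    multiplication is parallel. *)
Lemma nabla_frame_field (i : spin_index S) x v p : spin_dom i x ->
  frame_cliff i x (nabla x v (frame_field i p))
  = cliff gam (fun b => \sum_a p a * conn_coef i x v a b).
Proof.
move=> ix; apply: eq_bigr => b _; congr (_ *: _).
rewrite nabla_frame_coord //; last exact: smooth_frame_field_near.
rewrite (@tderiv_frame_const i x v _ (p b)) //; last by move=> y iy; exact: frame_field_ip.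
rewrite sub0r -sumrN; apply: eq_bigr => a _.
by rewrite frame_field_ip // (conn_coef_skew _ b a ix) mulrN opprK.
Qed.

Local Notation Omega i x v := (spin_conn (gam := gam) (conn_coef i x v)).

Lemma nablaSE x v eta : nablaS S nabla x v eta
  = tderiv x v (fun y => scoord (spin_at S x) y (eta y))
    + Omega (spin_at S x) x v *m eta x.
Proof.
rewrite /nablaS /spin_conn -scalemxAl mulmx_suml; congr (_ + _ *: _).
apply: eq_bigr => a _; rewrite mulmx_suml; apply: eq_bigr => b _.
by rewrite -scalemxAl.
Qed.

(** The connection matrix is skew, so moving it across the inner product leaves its commutator with
    [B]. *)
Lemma tderiv_sdot_nablaS (s t : M -> 'cV[R]_8) (B : 'M[R]_8) x v :
  smooth_spinor S s -> smooth_spinor S t ->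
  let i := spin_at S x in
  tderiv x v (fun y => sdot (scoord i y (s y)) (B *m scoord i y (t y)) : R)
  = sdot (nablaS S nabla x v s) (B *m t x) + sdot (s x) (B *m nablaS S nabla x v t)
    + sdot (s x) ((Omega i x v *m B - B *m Omega i x v) *m t x).
Proof.
move=> ss st i; have ix := spin_dom_at S x.
rewrite (tderiv_sdot _ _ (spin_dom_open i) ix (ss i) (st i)) !nablaSE !(scoord_at Hgam) //.
rewrite sdotDl mulmxDr sdotDr (sdot_adjoint (Omega _ _ _)) spin_conn_skew //; last first.
  by move=> a b; exact: conn_coef_skew.
rewrite mulmxBl -!mulmxA mulNmx sdotNr sdotDr sdotNr; ring.
Qed.

(** The bracket of the connection matrix with [P] is a sum of three terms, one per factor. They
    cancel the derivatives of the three fields in [nabla_form3], so only xi remains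
    differentiated. *)
Lemma nabla_form3_frame (xi : M -> 'cV[R]_8) x v p q r : smooth_spinor S xi ->
  let i := spin_at S x in
  let P := cliff gam p *m (cliff gam q *m cliff gam r) in
  nabla_form3 nabla (phi_spinor S xi) x v
    (frame_field i p) (frame_field i q) (frame_field i r)
  = - sdot (nablaS S nabla x v xi) (P *m xi x)
    - sdot (xi x) (P *m nablaS S nabla x v xi).
Proof.
move=> sxi i P; have ix := spin_dom_at S x.
have wsk a b : conn_coef i x v a b = - conn_coef i x v b a by exact: conn_coef_skew.
have phiE y Y Z W : spin_dom i y ->
    phi_spinor S xi y (@args R [:: Y; Z; W] 3)
    = - sdot (scoord i y (xi y)) ((frame_cliff i y Y *m (frame_cliff i y Z *m frame_cliff i y W))
        *m scoord i y (xi y)).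
  by move=> iy; rewrite (phi_spinorE Hg Hgam _ iy) /spinor_form /args /= !mulmxA.
rewrite /nabla_form3 !phiE //.
have -> : tderiv x v (fun y => phi_spinor S xi y
      (@args R [:: frame_field i p y; frame_field i q y; frame_field i r y] 3) : R^o)
    = tderiv x v (fun y => sdot (scoord i y (xi y)) ((- P) *m scoord i y (xi y)) : R).
  apply: (eq_tderiv _ (spin_dom_open i) ix) => y iy.
  by rewrite phiE // !frame_cliff_field // mulNmx sdotNr.
rewrite tderiv_sdot_nablaS // !nabla_frame_field // !frame_cliff_field // !(scoord_at Hgam) //.
rewrite -!(spin_conn_comm Hgam wsk) -/i.
set O := spin_conn _.
set c1 := _ *m (cliff gam q *m cliff gam r).
set c2 := cliff gam p *m (_ *m cliff gam r).
set c3 := cliff gam p *m (cliff gam q *m (_ - _)).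
have -> : O *m - P - - P *m O = - (c1 + c2 + c3).
  rewrite /c1 /c2 /c3 /P !mulmxBl !mulmxBr !mulNmx mulmxN -!mulmxA.
  by rewrite !addrA !subrK opprB opprK addrC.
move: c1 c2 c3 => c1 c2 c3.
by rewrite !mulNmx !mulmxDl !sdotNr !sdotDr; ring.
Qed.

End Connection.
End SpinGeometry.

(** * The G2-structure of a unit spinor *)

Section SpinorG2.
Context {R : realType} {M : manifold7 R}.
Local Notation E := 'rV[R]_7.
Context {g : M -> E -> E -> R} (Hg : riemannian_metric g).
Context {gam : 'I_7 -> 'M[R]_8} (Hgam : clifford_rep gam).
Context {S : spin_structure g gam}.
Context {xi : M -> 'cV[R]_8} (Hxi : smooth_spinor S xi).
Hypothesis Hunit : forall x : M, sdot (xi x) (xi x) = 1.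
Local Notation ip := (riemannian_inner_product Hg).
Local Notation phi := (phi_spinor S xi).
Local Notation at_ x := (spin_dom_at S x).
Local Notation G x := (frame_cliff (spin_at S x) x).

Lemma phi_spinor_at x : phi x = spinor_form (G := G x) (xi := xi x).
Proof. by rewrite (phi_spinorE Hg Hgam _ (at_ x)) (scoord_at Hgam). Qed.

Local Notation clx x := (frame_cliff_action Hg Hgam (at_ x)).

Lemma phi_spinor_multilinear x : multilinear (phi x).
Proof. rewrite phi_spinor_at; exact (spinor_form_multilinear (clx x)). Qed.

Lemma oct_frame_phi x f : oct_frame (h := g x) (G := G x) (xi := xi x) f ->
  oct_form (phi x) f.
Proof.
by move=> ff; rewrite phi_spinor_at; exact: (oct_frame_form (clx x) (Hunit x) ff).
Qed.

Lemma associated_volume_oct gphi vol x f : associated_metric_volume phi gphi vol ->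
  oct_frame (h := g x) (G := G x) (xi := xi x) f ->
  gphi x (f 0%N) (f 0%N) * vol x (fun i => f i) = 1.
Proof.
move=> [_ _ H] ff; rewrite H wedge_oct_form ?mulVf ?pnatr_eq0 //.
exact: oct_frame_phi.
Qed.

Lemma oct_frame_orthonormal x f : oct_frame (h := g x) (G := G x) (xi := xi x) f ->
  orthonormal_frame (g x) (fun i : 'I_7 => f i).
Proof. by move=> [fo _] i j; rewrite fo. Qed.

(** An adapted frame starting at an arbitrary unit vector provides the frame that [metric_of_volume]
    asks for. *)
Lemma associated_metric_spinor gphi vol : associated_metric_volume phi gphi vol ->
  gphi = g.
Proof.
move=> H; apply/funext => x; apply/funext => u; apply/funext => v.
have [Hr Hv _] := H.
apply: (metric_of_volume (ip x) (riemannian_inner_product Hr x) (frame_onb (at_ x)) (Hv x)).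
move=> w w1; have [f [f0 ff]] :=
  exists_oct_frame (ip x) (clx x) (Hunit x) (frame_onb (at_ x)) w1.
exists (fun i : 'I_7 => f i); split; first exact (oct_frame_orthonormal ff).
by rewrite -f0; exact (associated_volume_oct H ff).
Qed.

Lemma cross_phiP x u v w : g x (cross (g x) (phi x) u v) w = phi x (@args R [:: u; v; w] 3).
Proof.
apply: sharpP => [*|*|*|a p q]; [exact: (ip_linear (ip x))|exact: (ip_sym (ip x))
  |exact: (ip_pos (ip x))|].
exact: (args_affine (s1 := [:: u; v]) [::] (phi_spinor_multilinear x) isT).
Qed.

Section Torsion.
Context {nabla : M -> E -> (M -> E) -> E} (Hnabla : levi_civita g nabla).
Context {vol : M -> @kform R 7} (Hvol : associated_metric_volume phi g vol).
Context {T : M -> E -> E -> R} (HT : is_torsion g vol nabla phi T).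

Local Notation tau x v := (sharp (g x) (T x v)).

Lemma sharp_torsionP x v w : g x (tau x v) w = T x v w.
Proof.
apply: sharpP => [*|*|*|a p q]; [exact: (ip_linear (ip x))|exact: (ip_sym (ip x))
  |exact: (ip_pos (ip x))|].
by case: HT => -[_ Tl _] _; exact: Tl.
Qed.

Lemma nablaS_unit x v : sdot (xi x) (nablaS S nabla x v xi) = 0.
Proof.
have ix := at_ x.
have := tderiv_sdot_nablaS Hg Hgam Hnabla 1%:M x v Hxi Hxi.
move=> /=.
rewrite (@tderiv_frame_const _ _ _ _ S (spin_at S x) x v _ 1) //; last first.
  by move=> y iy; rewrite mul1mx (sdot_scoord Hgam).
rewrite !mul1mx mulmx1 subrr mul0mx (sdotC (nablaS _ _ _ _ _)).
have -> : sdot (xi x) 0 = 0 by rewrite /sdot mulmx0 mxE.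
lra.
Qed.

Lemma nablaS_xi x v : nablaS S nabla x v xi = - (G x (tau x v) *m xi x).
Proof.
have ix := at_ x; have cl := clx x; have x1 := Hunit x.
rewrite -mulNmx -(clN cl) [LHS](spinor_expand (ip x) cl x1 (frame_onb ix)) nablaS_unit.
rewrite scale0r add0r; congr (frame_cliff _ _ _ *m _).
set b := spinor_vec _.
apply (ip_frame_inj (ip x) (frame_onb ix)) => a.
(* The adapted frame starts at the frame vector [a], so that one evaluation of nabla phi yields the
   component [a] of [b]. *)
have [|f [f0 ff]] := exists_oct_frame (ip x) cl x1 (frame_onb ix) (u := frame (spin_at S x) a x).
  by rewrite frame_orthonormal // eqxx.
rewrite -f0 (ipNl (ip x)).
pose p k c := g x (f k) (frame (spin_at S x) c x).
have fE k : frame_field (spin_at S x) (p k) x = f k.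
  by rewrite -(frame_field_expand Hg (f k) ix).
have sF k : smooth_vfield_near x (frame_field (spin_at S x) (p k)).
  exact: smooth_frame_field_near.
have vol1 : vol x (fun i => f i) = 1.
  have := associated_volume_oct Hvol ff.
  by rewrite f0 frame_orthonormal // eqxx mul1r.
have [_ /(_ x v _ _ _ (sF 2%N) (sF 4%N) (sF 6%N))] := HT.
have [_ Hv _] := Hvol.
rewrite !fE (hodge_oct_form (ip x) _ (phi_spinor_multilinear x) (Hv x).1
  (oct_frame_phi ff) (oct_frame_orthonormal ff) vol1).
rewrite (nabla_form3_frame Hg Hgam Hnabla _ _ _ _ _ Hxi).
have -> : nablaS S nabla x v xi = G x b *m xi x.
  by rewrite [LHS](spinor_expand (ip x) cl x1 (frame_onb ix)) nablaS_unit scale0r add0r.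
rewrite -!(frame_cliff_field Hg _ ix) !fE -!mulmxA.
have [_ fm] := ff.
(* On xi, f4.f6 = - f1 and f2.f1 = - f0. *)
have -> : G x (f 2%N) *m (G x (f 4%N) *m (G x (f 6%N) *m xi x)) = G x (f 0%N) *m xi x.
  rewrite (fm 4%N 6%N) // -scalemxAr (fm 2%N 1%N) // scalerA -[RHS]scale1r.
  by congr (_ *: _); rewrite -rmorphM.
(* Transposing three factors reverses them with a sign, and f6.f4.f2 = f6.f5 = - f0 on xi. The signs
   cancel, so the two terms of nabla phi add up to the factor 2. *)
have -> : sdot (xi x) (G x (f 2%N) *m (G x (f 4%N) *m (G x (f 6%N) *m (G x b *m xi x))))
    = g x (f 0%N) b.
  rewrite -[LHS]opprK -(cl_adj cl) -[X in - X]opprK -(cl_adj cl) -[X in - - X]opprK -(cl_adj cl).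
  rewrite (fm 4%N 2%N) // -scalemxAr (fm 6%N 5%N) // scalerA sdotZl.
  rewrite (sdot_cl_unit cl x1) opprK -mulNr -[RHS]mul1r.
  by congr (_ * _); rewrite -rmorphM -rmorphN.
rewrite (sdot_cl_unit cl x1) (ip_sym (ip x) (f 0%N)); lra.
Qed.

End Torsion.
End SpinorG2.

(** * The octonion field of a spinor and its derivative *)

Section OctonionDerivative.
Context {R : realType} {M : manifold7 R}.
Local Notation E := 'rV[R]_7.
Context {g : M -> E -> E -> R} (Hg : riemannian_metric g).
Context {gam : 'I_7 -> 'M[R]_8} (Hgam : clifford_rep gam).
Context {S : spin_structure g gam}.
Context {xi : M -> 'cV[R]_8} (Hxi : smooth_spinor S xi).
Hypothesis Hunit : forall x : M, sdot (xi x) (xi x) = 1.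
Local Notation ip := (riemannian_inner_product Hg).
Local Notation phi := (phi_spinor S xi).
Local Notation at_ x := (spin_dom_at S x).
Local Notation G x := (frame_cliff (spin_at S x) x).
Local Notation clx x := (frame_cliff_action Hg Hgam (at_ x)).

Local Notation oct eta := (@spinor_oct R M g gam S xi eta).

Lemma spinor_octP (eta : M -> 'cV[R]_8) (i : spin_index S) y v : spin_dom i y ->
  g y (oct eta y).2 v
  = sdot (frame_cliff i y v *m scoord i y (xi y)) (scoord i y (eta y)).
Proof.
move=> iy; rewrite /= (spinor_vecP (ip y) (clx y)) -(sdot_scoord Hgam _ _ iy).
by rewrite -[frame_cliff (spin_at S y) y v *m _]/(cmul S y v _) (scoord_cmul Hg Hgam _ _ iy).
Qed.

Lemma spinor_oct_frame (eta : M -> 'cV[R]_8) (i : spin_index S) y a : spin_dom i y ->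
  g y (oct eta y).2 (frame i a y)
  = sdot (scoord i y (xi y)) ((- gam a) *m scoord i y (eta y)).
Proof.
move=> iy; rewrite (spinor_octP _ _ iy) frame_cliff_frame //.
by rewrite sdot_adjoint Hgam.1.
Qed.

Lemma smooth_local (f : M -> R) :
  (forall i : spin_index S, smooth_fun (spin_dom i) f) -> smooth_fun setT f.
Proof.
by move=> H; apply: smooth_fun_cover => x _; exists (spin_dom (spin_at S x)) => //; exact: (at_ x).
Qed.

Lemma smooth_vfield_frame (Y : M -> E) :
  (forall i : spin_index S, forall a,
     smooth_fun (spin_dom i) (fun y => g y (Y y) (frame i a y) : R)) ->
  smooth_vfield setT Y.
Proof.
move=> H; apply: smooth_vfield_cover => x _; exists (spin_dom (spin_at S x)); first exact: (at_ x).
set i := spin_at S x; have oi := spin_dom_open i.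
apply: (@eq_smooth_vfield _ _ _
  (fun y => \sum_a g y (Y y) (frame i a y) *: frame i a y)) => //.
  by move=> y iy; rewrite [RHS](orthonormal_expand (ip y) (frame_onb iy)).
apply: smooth_vfield_sum => // a.
by apply: smooth_vfield_scale => //; exact: frame_smooth.
Qed.

Lemma smooth_spinor_oct eta : smooth_spinor S eta -> smooth_octonion (oct eta).
Proof.
move=> seta; split.
  apply: smooth_local => i; have oi := spin_dom_open i.
  apply: (@eq_smooth_fun _ _ _ _
    (fun y => sdot (scoord i y (xi y)) (1%:M *m scoord i y (eta y)) : R)) => //.
    by move=> y iy; rewrite mul1mx (sdot_scoord Hgam).
  by apply: smooth_sdot.
apply: smooth_vfield_frame => i a; have oi := spin_dom_open i.
apply: (@eq_smooth_fun _ _ _ _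
  (fun y => sdot (scoord i y (xi y)) ((- gam a) *m scoord i y (eta y)) : R)) => //.
  by move=> y iy; rewrite spinor_oct_frame.
by apply: smooth_sdot.
Qed.

Context {nabla : M -> E -> (M -> E) -> E} (Hnabla : levi_civita g nabla).

Lemma smooth_tderiv (f : M -> R) (X : M -> E) : smooth_fun setT f ->
  smooth_vfield setT X ->
  smooth_fun setT (fun x => tderiv x (X x) (f : M -> R^o) : R).
Proof.
move=> sf sX; apply: smooth_local => i; have oi := spin_dom_open i.
pose e0 : M -> E := frame i ord0.
have se : smooth_vfield (spin_dom i) e0 by exact: frame_smooth.
have sfi : smooth_fun (spin_dom i) f by apply: smooth_fun_sub sf.
have sXi : smooth_vfield (spin_dom i) X by apply: smooth_vfield_sub sX.
have sfe := smooth_vfield_scale oi sfi se.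
have tg : tensor2 g by case: Hg.
(* <nabla_X (f e), e> = X f for a unit field e *)
apply: eq_smooth_fun (tensor2_smooth_fun tg oi (nabla_smooth Hnabla oi sXi sfe) se) => //.
move=> x ix.
have nf : smooth_fun_near x f by exists (spin_dom i).
rewrite (nabla_leibniz Hnabla _ nf (smooth_frame_near ord0 ix)).
rewrite (ip_linear (ip x)) frame_orthonormal // eqxx mulr1 (ipZl (ip x)).
have := conn_coef_skew Hg Hnabla (X x) ord0 ord0 ix; rewrite /conn_coef -/e0 => e.
have -> : g x (nabla x (X x) e0) (e0 x) = 0 by lra.
by rewrite mulr0 addr0.
Qed.

Context {vol : M -> @kform R 7} (Hvol : associated_metric_volume phi g vol).
Context {T : M -> E -> E -> R} (HT : is_torsion g vol nabla phi T).

Lemma sdot_cliff2 p q (s t : 'cV[R]_8) :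
  sdot s (cliff gam p *m (cliff gam q *m t))
  = \sum_b \sum_c (p b * q c) * sdot s ((gam b *m gam c) *m t).
Proof.
have sdot_sum I (r : seq I) (f : I -> 'cV[R]_8) u :
    sdot u (\sum_(k <- r) f k) = \sum_(k <- r) sdot u (f k).
  elim: r => [|k r IH]; last by rewrite !big_cons sdotDr IH.
  by rewrite !big_nil /sdot mulmx0 mxE.
rewrite /cliff mulmx_suml sdot_sum; apply: eq_bigr => b _.
rewrite mulmx_suml mulmx_sumr sdot_sum; apply: eq_bigr => c _.
by rewrite -!scalemxAl -scalemxAr !sdotZr !mulrA -mulmxA.
Qed.

Lemma smooth_octonion_D X A : smooth_vfield setT X -> smooth_octonion A ->
  smooth_octonion (octonion_D g nabla phi T X A).
Proof.
move=> sX [sA1 sA2]; have oT : open [set: M] by exact: openT.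
have tT : tensor2 T by case: HT.
have tg : tensor2 g by case: Hg.
pose tau x := sharp (g x) (T x (X x)).
have tauE x w : g x (tau x) w = T x (X x) w by exact: (sharp_torsionP Hg HT).
have sub (i : spin_index S) : spin_dom i `<=` [set: M] by [].
have stau : smooth_vfield setT tau.
  apply: smooth_vfield_frame => i a; have oi := spin_dom_open i.
  have sT : smooth_fun (spin_dom i) (fun y => T y (X y) (frame i a y) : R).
    exact (tensor2_smooth_fun (X := X) (Y := frame i a) tT oi
      (smooth_vfield_sub (sub i) sX) (frame_smooth i a)).
  apply: (@eq_smooth_fun _ _ _ _ (fun y => T y (X y) (frame i a y) : R) _ oi _ sT).
  by move=> y _ /=; rewrite tauE.
split.
  apply: (@eq_smooth_fun _ _ R _ (fun x => tderiv x (X x) (fun y => (A y).1 : R^o)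
      + T x (X x) (A x).2 : R)) => //.
    by move=> x _; rewrite /= mulr0 sub0r opprK (ip_sym (ip x)) (sharp_torsionP Hg HT).
  apply: smooth_funD => //; first exact: smooth_tderiv.
  exact (tensor2_smooth_fun (X := X) (Y := fun x => (A x).2) tT oT sX sA2).
apply: smooth_vfield_frame => i a; have oi := spin_dom_open i.
have sAi := smooth_vfield_sub (sub i) sA2; have sti := smooth_vfield_sub (sub i) stau.
have sXi := smooth_vfield_sub (sub i) sX.
have se b : smooth_vfield (spin_dom i) (frame (s := S) i b) by exact: frame_smooth.
(* In the frame, the cross product term phi(A, tau, e_a) is a combination of functions <xi, B xi>
   with these constant matrices, so [smooth_sdot] applies. *)
pose B b c := - (gam b *m gam c *m gam a).
apply: (@eq_smooth_fun _ _ R _ (fun x => g x (nabla x (X x) (fun y => (A y).2)) (frame i a x)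
   + (- 1 * ((A x).1 * g x (tau x) (frame i a x))
   + - 1 * \sum_b \sum_c (g x (A x).2 (frame i b x) * g x (tau x) (frame i c x))
        * sdot (scoord i x (xi x)) (B b c *m scoord i x (xi x))) : R)) => //.
  move=> x ix; rewrite /= scale0r addr0 (ipDl (ip x)) (ipNl (ip x)) (ipDl (ip x)) (ipZl (ip x)).
  rewrite (cross_phiP Hg Hgam) (phi_spinorE Hg Hgam _ ix) /spinor_form /args /=.
  rewrite frame_cliff_frame // sdot_cliff2 -/(tau x).
  set s1 := \sum_b \sum_c _; set s2 := \sum_b \sum_c _.
  have -> : s1 = - s2.
    rewrite /s1 /s2 -sumrN; apply: eq_bigr => b _; rewrite -sumrN; apply: eq_bigr => c _.
    by rewrite /B mulNmx sdotNr mulrN -!mulmxA.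
  by ring.
have sg Y b : smooth_vfield (spin_dom i) Y ->
    smooth_fun (spin_dom i) (fun x => g x (Y x) (frame i b x) : R).
  by move=> sY; exact (tensor2_smooth_fun (X := Y) (Y := frame i b) tg oi sY (se b)).
apply: smooth_funD => //; first exact: sg (nabla_smooth Hnabla oi sXi sAi).
apply: smooth_funD => //; apply: smooth_funM => //; try exact: smooth_fun_cst.
  by apply: smooth_funM => //; [exact: smooth_fun_sub sA1|exact: sg].
apply: smooth_fun_sum => // b; apply: smooth_fun_sum => // c.
apply: smooth_funM => //; first by apply: smooth_funM => //; exact: sg.
by apply: smooth_sdot.
Qed.

(** The two spinors are compared along xi and along each e_a . xi, using [tderiv_sdot_nablaS] with B
    = 1 and B = - gam_a. The terms containing nabla^S xi = - T_X . xi produce the octonion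
    product. *)
Lemma nablaS_octonion_D X eta x : smooth_spinor S eta ->
  nablaS S nabla x (X x) eta
  = omul S x (octonion_D g nabla phi T X (oct eta) x) (xi x).
Proof.
move=> seta; have ix := at_ x; have cl := clx x; have x1 := Hunit x.
set A := oct eta; set i := spin_at S x.
have [sA1 sA2] := smooth_spinor_oct seta.
pose t := sharp (g x) (T x (X x)).
have nxi : nablaS S nabla x (X x) xi = - (G x t *m xi x).
  exact: (nablaS_xi Hg Hgam Hxi Hunit Hnabla Hvol HT).
have etaE : eta x = (A x).1 *: xi x + G x (A x).2 *m xi x.
  by rewrite -[LHS](omul_spinor_oct Hg Hgam (S := S) eta x1).
rewrite [LHS](spinor_expand (ip x) cl x1 (frame_onb ix)) /omul.
congr (_ *: _ + _).
  have := tderiv_sdot_nablaS Hg Hgam Hnabla 1%:M x (X x) Hxi seta.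
  rewrite /= !mul1mx mulmx1 subrr mul0mx nxi.
  have -> : sdot (xi x) (0 : 'cV_8) = 0 by rewrite /sdot mulmx0 mxE.
  rewrite (@eq_tderiv _ _ R^o (spin_dom i) _ (fun y => (A y).1) x (X x) (spin_dom_open i) ix);
    last by move=> y iy; rewrite mul1mx (sdot_scoord Hgam).
  rewrite sdotNl [X in - sdot _ X]etaE sdotDr sdotZr sdotC (sdot_cl cl) mulr0 add0r.
  rewrite (sdot_cl_unit cl x1) (ip_sym (ip x) t) addr0 => ->.
  by rewrite /= -/t; ring.
congr (frame_cliff _ _ _ *m _).
apply (ip_frame_inj (ip x) (frame_onb ix)) => a.
rewrite (spinor_vecP (ip x) cl) (cl_adj cl).
set e := frame i a x; pose w := conn_coef i (nabla := nabla) x (X x).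
have wsk b c : w b c = - w c b by exact: (conn_coef_skew Hg Hnabla).
have eE : gam a = G x e by rewrite frame_cliff_frame.
have H2 := tderiv_sdot_nablaS Hg Hgam Hnabla (- gam a) x (X x) Hxi seta.
have dA : tderiv x (X x) (fun y => sdot (scoord i y (xi y)) (- gam a *m scoord i y (eta y)) : R)
    = tderiv x (X x) (fun y => g y (A y).2 (frame i a y) : R^o).
  apply: (eq_tderiv _ (spin_dom_open i) ix) => y iy.
  by rewrite (spinor_oct_frame _ _ iy).
have snA : smooth_vfield_near x (fun y => (A y).2) by exists setT; split=> //; exact: openT.
have := nabla_frame_coord Hg Hnabla (X x) a ix snA.
rewrite -/e -/w -dA H2 -/i -/w.
have -> : (octonion_D g nabla phi T X A x).2 = nabla x (X x) (fun y => (A y).2)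
    - ((A x).1 *: t + 0 *: (A x).2 + cross (g x) (phi x) (A x).2 t) by [].
set O := spin_conn (gam := gam) w.
(* This bracket yields exactly the connection coefficients that [nabla_frame_coord] subtracts. *)
have -> : O *m - gam a - - gam a *m O
    = - G x (frame_field i (w a) x).
  have -> : O *m - gam a - - gam a *m O
      = - (O *m gam a - gam a *m O).
    by rewrite mulNmx mulmxN opprB opprK addrC.
  congr (- _).
  rewrite eE /frame_cliff (spin_conn_comm Hgam wsk) -/(frame_cliff _ _ _) frame_cliff_field //.
  rewrite /cliff; apply: eq_bigr => b _; congr (_ *: _).
  rewrite (bigD1 a) //= frame_orthonormal // eqxx mul1r big1 ?addr0 // => c /negbTE ca.
  by rewrite /e frame_orthonormal // eq_sym ca mul0r.
have -> : sdot (xi x) (- G x (frame_field i (w a) x) *m eta x)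
    = \sum_b g x (A x).2 (frame i b x) * w a b.
  rewrite mulNmx sdotNr -(cl_adj cl) -(spinor_vecP (ip x) cl) /frame_field (ip_sumr (ip x)).
  by apply: eq_bigr => b _; rewrite mulrC.
rewrite !mulNmx !sdotNr nxi sdotNl opprK eE -/t.
(* Cyclic symmetry of phi: [e] and the vector part of A anticommute up to a multiple of xi, which is
   orthogonal to t . xi. *)
have cyc : sdot (G x t *m xi x) (G x e *m (G x (A x).2 *m xi x))
    = phi x (@args R [:: (A x).2; t; e] 3).
  rewrite (phi_spinor_at Hg Hgam) (spinor_formE cl) (cl_adj cl) (cl_swap cl).
  rewrite sdotDr !sdotNr sdotZr (sdot_cl cl) mulr0 oppr0 addr0 opprK.
  by rewrite [RHS]sdotC !(cl_adj cl) opprK.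
rewrite (ipDl (ip x)) (ipNl (ip x)) !(ipDl (ip x)) !(ipZl (ip x)) mul0r addr0.
rewrite (cross_phiP Hg Hgam) -cyc etaE mulmxDr -scalemxAr sdotDr sdotZr.
by rewrite (sdot_cl_unit cl x1) => ->; rewrite -(cl_adj cl); ring.
Qed.

End OctonionDerivative.

(** * The map j and the choice of Levi-Civita connection *)

Section JMap.
Context {R : realType} {M : manifold7 R}.
Local Notation E := 'rV[R]_7.
Context {g : M -> E -> E -> R} (Hg : riemannian_metric g).
Context {gam : 'I_7 -> 'M[R]_8} (Hgam : clifford_rep gam).
Context {S : spin_structure g gam}.
Context {xi : M -> 'cV[R]_8}.
Local Notation phi := (phi_spinor S xi).

Lemma octmul_one x (A : R^o * E) : octmul (g x) (phi x) A (1, 0) = A.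
Proof.
have ip := riemannian_inner_product Hg x.
have -> : octmul (g x) (phi x) A (1, 0)
    = (A.1 * 1 - g x A.2 0, A.1 *: 0 + 1 *: A.2 + cross (g x) (phi x) A.2 0) by [].
have -> : cross (g x) (phi x) A.2 0 = 0.
  apply: (ip_eq0 ip); rewrite (cross_phiP Hg Hgam) (phi_spinor_at Hg Hgam).
  have cl := frame_cliff_action Hg Hgam (spin_dom_at S x).
  by rewrite (spinor_formE cl) (cl0 cl) mul0mx /sdot mulmx0 mxE.
by rewrite (ip0r ip) mulr1 subr0 scaler0 add0r scale1r addr0; case: A.
Qed.

Lemma j_map_spinor (j : (M -> 'cV[R]_8) -> (M -> R^o * E)) (A : M -> R^o * E) x :
  is_j_map S g phi xi j -> smooth_spinor S xi -> smooth_octonion A ->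
  j (fun y => omul S y (A y) (xi y)) x = A x.
Proof. by move=> Hj sxi sA; rewrite (j_mul Hj sA sxi) (j_xi Hj) octmul_one. Qed.

(** The spinor derivative is lifted from [nabla], whereas torsion and D use [nablaphi]; this lemma
    identifies the two lifts. *)
Lemma eq_nablaS n1 n2 x v eta : levi_civita g n1 -> levi_civita g n2 ->
  nablaS S n1 x v eta = nablaS S n2 x v eta.
Proof.
move=> l1 l2; rewrite /nablaS; congr (_ + _ *: _).
apply: eq_bigr => a _; apply: eq_bigr => b _.
by rewrite (levi_civita_unique Hg (S := S) l1 l2 _ (smooth_frame_near a (spin_dom_at S x))).
Qed.

End JMap.

Theorem theorem8p5 (R : realType) (M : manifold7 R)
    (g : M -> 'rV[R]_7 -> 'rV[R]_7 -> R) (Hg : riemannian_metric g)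
    (gam : 'I_7 -> 'M[R]_8) (Hgam : clifford_rep gam)
    (S : spin_structure g gam)
    (nabla : M -> 'rV[R]_7 -> (M -> 'rV[R]_7) -> 'rV[R]_7)
    (Hnabla : levi_civita g nabla)
    (xi : M -> 'cV[R]_8) (Hxi : smooth_spinor S xi)
    (Hunit : forall x : M, sdot (xi x) (xi x) = 1)
    (gphi : M -> 'rV[R]_7 -> 'rV[R]_7 -> R) (vol : M -> @kform R 7)
    (Hgphi : associated_metric_volume (phi_spinor S xi) gphi vol)
    (nablaphi : M -> 'rV[R]_7 -> (M -> 'rV[R]_7) -> 'rV[R]_7)
    (Hnablaphi : levi_civita gphi nablaphi)
    (T : M -> 'rV[R]_7 -> 'rV[R]_7 -> R)
    (HT : is_torsion gphi vol nablaphi (phi_spinor S xi) T)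
    (j : (M -> 'cV[R]_8) -> (M -> R^o * 'rV[R]_7))
    (Hj : is_j_map S gphi (phi_spinor S xi) xi j)
    (eta : M -> 'cV[R]_8) (Heta : smooth_spinor S eta)
    (X : M -> 'rV[R]_7) (HX : smooth_vfield setT X) (x : M) :
  j (fun y => nablaS S nabla y (X y) eta) x
  = octonion_D gphi nablaphi (phi_spinor S xi) T X (j eta) x.
Proof.
have gE := associated_metric_spinor Hg Hgam Hunit Hgphi.
rewrite gE in Hgphi Hnablaphi HT Hj *.
set A := @spinor_oct R M g gam S xi.
have jE zeta : smooth_spinor S zeta -> j zeta = A zeta.
  move=> sz; apply/funext => y; have sA := smooth_spinor_oct Hg Hgam Hxi sz.
  rewrite -[RHS](j_map_spinor Hg Hgam y Hj Hxi sA); congr (j _ _).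
  by apply/funext => z; rewrite (omul_spinor_oct Hg Hgam zeta (Hunit z)).
(* Writing D_X A as j of (D_X A) . xi leaves two spinor fields to compare, and the smoothness of D_X
   A as the last goal. *)
rewrite (jE _ Heta) -[RHS](j_map_spinor Hg Hgam x Hj Hxi).
  congr (j _ _); apply/funext => y; rewrite (eq_nablaS Hg _ _ _ Hnabla Hnablaphi).
  exact (nablaS_octonion_D Hg Hgam Hxi Hunit Hnablaphi Hgphi HT X y Heta).
exact (smooth_octonion_D Hg Hgam Hxi Hnablaphi HT HX (smooth_spinor_oct Hg Hgam Hxi Heta)).
Qed.
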